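(* Let $G$ be either the group $\mathrm{PAff}_+(\mathbf S^1)$ of piecewise-affine circle homeomorphisms or the group $\mathrm{Diff}^{\infty}(\mathbb R/\mathbb Z)$ of smooth circle diffeomorphisms. Then for every irrational $\alpha\in\mathbb R$ the rotation $T_\alpha$ is distorted in $G$. (The assertion holds for each of the two choices of $G$.)
   Context: The circle is $\mathbf S^1=\mathbb R/\mathbb Z$, and $T_\alpha(x)=x+\alpha \pmod 1$ is the rotation by $\alpha$. $\mathrm{PAff}_+(\mathbf S^1)$ is the group, under composition, of orientation-preserving homeomorphisms of $\mathbf S^1$ that are piecewise affine (affine on each of finitely many intervals partitioning the circle). $\mathrm{Diff}^{\infty}(\mathbb R/\mathbb Z)$ is the group, under composition, of $C^\infty$ diffeomorphisms of $\mathbb R/\mathbb Z$. Word metric: for a group $\Gamma$ with a finite generating set $\mathcal G$, $d_{\mathcal G}(g_1,g_2)$ is the infimum of all $k\ge 0$ such that there exist $f_1,\dots,f_k\in\mathcal G$ and $\epsilon_1,\dots,\epsilon_k\in\{-1,1\}$ with $g_2=f_1^{\epsilon_1}\cdots f_k^{\epsilon_k}g_1$. Distortion: an element $f$ of a group $H$ is called distorted in $H$ if there exists a finitely generated subgroup $\Gamma\subset H$ containing $f$ such that $\lim_{n\to\infty} d_{\mathcal G}(f^n,\mathrm{id})/n=0$ for some (equivalently, every) finite generating set $\mathcal G$ of $\Gamma$. *)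

(* Defs.v *)
From HB Require Import structures.
From mathcomp Require Import all_boot all_order all_algebra.
From mathcomp Require Import all_classical all_reals all_analysis.

Set Implicit Arguments.
Unset Strict Implicit.
Unset Printing Implicit Defensive.

Import Order.TTheory GRing.Theory Num.Theory.
Import numFieldNormedType.Exports.

Local Open Scope classical_set_scope.
Local Open Scope ring_scope.
Local Open Scope quotient_scope.

Section Circle.
Variable R : realType.

Definition circle_rel : rel R := fun x y => x - y \is a Num.int.

Lemma circle_rel_equiv : equiv_class_of circle_rel.
Proof.
split=> [x|x y|y x z] //; rewrite /circle_rel.
- by rewrite subrr rpred0.
- by rewrite -(opprB y x) rpredN.
- by move=> xy yz; rewrite -(subrKA y); exact: rpredD.
Qed.

Canonical circle_equiv_rel := EquivRelPack circle_rel_equiv.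

(* R/Z with the quotient topology. *)
Definition circle : Type := quotient_topology {eq_quot circle_equiv_rel}.

HB.instance Definition _ := Quotient.on circle.
HB.instance Definition _ := Topological.on circle.

Lemma circle_piP (x y : R) :
  reflect (\pi_circle x = \pi_circle y) (x - y \is a Num.int).
Proof. exact: (@eqquotP _ circle_equiv_rel {eq_quot circle_equiv_rel} x y).
Qed.

End Circle.

(* The group of self-homeomorphisms of T; in this group (f * g)%g is f \o g. *)
Section Homeo.
Variable T : topologicalType.

Record homeo := Homeo {
  homeo_fun :> T -> T;
  homeo_inv : T -> T;
  homeo_funK : cancel homeo_fun homeo_inv;
  homeo_invK : cancel homeo_inv homeo_fun;
  homeo_fun_continuous : continuous homeo_fun;
  homeo_inv_continuous : continuous homeo_inv }.

Lemma homeo_eqP (f g : homeo) : f =1 g -> f = g.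
Proof.
case: f g => [f f' fK f'K cf cf'] [g g' gK g'K cg cg'] /= fg.
have fgE : f = g by exact/funext.
have fgE' : f' = g'.
  by apply/funext => x; rewrite -{1}(g'K x) -fgE fK.
by subst; congr Homeo; exact: Prop_irrelevance.
Qed.

HB.instance Definition _ := gen_eqMixin homeo.
HB.instance Definition _ := gen_choiceMixin homeo.

Definition homeo_one : homeo :=
  @Homeo idfun idfun (fun=> erefl) (fun=> erefl)
    (fun x => cvg_id) (fun x => cvg_id).

Definition homeo_opp (f : homeo) : homeo :=
  Homeo (@homeo_invK f) (@homeo_funK f)
    (@homeo_inv_continuous f) (@homeo_fun_continuous f).

Definition homeo_mul (f g : homeo) : homeo :=
  @Homeo (f \o g) (homeo_inv g \o homeo_inv f)
    (can_comp (@homeo_funK f) (@homeo_funK g))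
    (can_comp (@homeo_invK g) (@homeo_invK f))
    (fun x => continuous_comp (@homeo_fun_continuous g x)
                              (@homeo_fun_continuous f (g x)))
    (fun x => continuous_comp (@homeo_inv_continuous f x)
                              (@homeo_inv_continuous g (homeo_inv f x))).

Lemma homeo_mulA : associative homeo_mul.
Proof. by move=> f g h; exact: homeo_eqP. Qed.

Lemma homeo_mul1 : left_id homeo_one homeo_mul.
Proof. by move=> f; exact: homeo_eqP. Qed.

Lemma homeo_mulr1 : right_id homeo_one homeo_mul.
Proof. by move=> f; exact: homeo_eqP. Qed.

Lemma homeo_mulV : left_inverse homeo_one homeo_opp homeo_mul.
Proof. by move=> f; apply: homeo_eqP => x /=; rewrite homeo_funK. Qed.

Lemma homeo_mulrV : right_inverse homeo_one homeo_opp homeo_mul.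
Proof. by move=> f; apply: homeo_eqP => x /=; rewrite homeo_invK. Qed.

HB.instance Definition _ := isGroup.Build homeo
  homeo_mulA homeo_mul1 homeo_mulr1 homeo_mulV homeo_mulrV.

End Homeo.

Section Distortion.
Variables (R : realType) (G : groupType).
Local Open Scope group_scope.

Definition is_subgroup (A : set G) : Prop := group_closed [in A].

Definition generated (S : set G) : set G := smallest is_subgroup S.

(* e i = true stands for the exponent -1; the value is +oo when g2 cannot be
   reached from g1. *)
Definition word_dist (S : set G) (g1 g2 : G) : \bar R :=
  ereal_inf [set (k%:R)%:E | k in [set k : nat |
    exists (f : 'I_k -> G) (e : 'I_k -> bool),
      (forall i, S (f i)) /\
      g2 = (\prod_(i < k) (if e i then (f i)^-1 else f i)) * g1]].

Definition distorted_in (H : set G) (f : G) : Prop :=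
  exists Gamma : set G,
    [/\ is_subgroup Gamma, Gamma `<=` H, Gamma f &
      exists S : set G,
        [/\ finite_set S, generated S = Gamma &
          (fun n : nat => word_dist S (f ^+ n) 1 * (n%:R^-1)%R%:E)%E @ \oo
            --> 0%E]].

End Distortion.

Section CircleGroups.
Variable R : realType.
Local Notation S1 := (circle R).

Definition is_lift (f : S1 -> S1) (F : R -> R) : Prop :=
  forall x, f (\pi_S1 x) = \pi_S1 (F x).

Definition orientation_preserving (f : S1 -> S1) : Prop :=
  exists F : R -> R, [/\ continuous F, {homo F : x y / x < y} & is_lift f F].

(* The images in R/Z of the intervals [t_i, t_(i+1)[, for a subdivision
   a = t_0 < ... < t_m = a + 1, partition the circle. *)
Definition piecewise_affine (f : S1 -> S1) : Prop :=
  exists (a : R) (s : seq R), itv_partition a (a + 1) s /\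
    forall i, (i < size s)%N -> exists l c : R,
      forall x : R, nth 0 (a :: s) i <= x < nth 0 (a :: s) i.+1 ->
        f (\pi_S1 x) = \pi_S1 (l * x + c).

Definition PAff_plus : set (homeo S1) :=
  [set f : homeo S1 | orientation_preserving f /\ piecewise_affine f].

Definition smooth_real (F : R -> R) : Prop :=
  forall (n : nat) (x : R), derivable (F^`(n))%classic x 1.

(* x |-> class of x is a local diffeomorphism R -> R/Z and R is simply connected,
   so a self-map of R/Z is C^oo iff it has a C^oo lift to R. *)
Definition smooth_circle (f : S1 -> S1) : Prop :=
  exists F : R -> R, smooth_real F /\ is_lift f F.

Definition Diff_infty : set (homeo S1) :=
  [set f : homeo S1 | smooth_circle f /\ smooth_circle (f^-1)%g].

Definition rot_fun (a : R) (x : S1) : S1 := \pi_S1 (repr x + a).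

Lemma rot_fun_lift a : is_lift (rot_fun a) (fun x => x + a).
Proof.
move=> x; apply/circle_piP.
have -> : repr (\pi_S1 x) + a - (x + a) = repr (\pi_S1 x) - x.
  by rewrite opprD addrACA subrr addr0.
by apply/circle_piP; rewrite reprK.
Qed.

Lemma rot_funD a b x : rot_fun a (rot_fun b x) = rot_fun (b + a) x.
Proof.
have -> : rot_fun b x = \pi_S1 (repr x + b) by [].
by rewrite rot_fun_lift -addrA.
Qed.

Lemma rot_fun0 x : rot_fun 0 x = x.
Proof. by rewrite /rot_fun addr0 reprK. Qed.

Lemma rot_funK a : cancel (rot_fun a) (rot_fun (- a)).
Proof. by move=> x; rewrite rot_funD subrr rot_fun0. Qed.

Lemma rot_funNK a : cancel (rot_fun (- a)) (rot_fun a).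
Proof. by move=> x; rewrite rot_funD addNr rot_fun0. Qed.

Lemma rot_fun_continuous a : continuous (rot_fun a).
Proof.
apply/quotient_continuous.
have -> : rot_fun a \o \pi_S1 = \pi_S1 \o (fun x : R => x + a).
  by apply/funext => x; exact: rot_fun_lift.
move=> x; apply: continuous_comp; last exact: pi_continuous.
by apply: cvgD; [exact: cvg_id|exact: cvg_cst].
Qed.

Definition rotation (a : R) : homeo S1 :=
  Homeo (@rot_funK a) (@rot_funNK a)
    (@rot_fun_continuous a) (@rot_fun_continuous (- a)).

End CircleGroups.

Arguments PAff_plus R : clear implicits.
Arguments Diff_infty R : clear implicits.
Arguments rotation R a : clear implicits.

(* Main.v *)
Require Import Defs.
From mathcomp Require Import all_boot all_order all_algebra.
From mathcomp Require Import all_classical all_reals all_analysis.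
From HB Require Import structures.
From mathcomp Require Import ring lra zify.

(** Only rotations and bump homeomorphisms that are affine of slope 2 or 1/2 on
prescribed intervals are used, so that both groups are treated at once.

If w is the rotation by beta on an interval J and D contracts J by 1/2, then
D^-1 w D is the rotation by 2 beta on J. Correcting by a small rotation at each
step gives words w of length O(K) that coincide on J with the rotation R of
angle n_K alpha, where n_K >= 2^K. Such a w is uncontrolled off J, but
w g w^-1 = R g R^-1 for g supported in J, so that R g R^-1 is short, i.e. of
length O(K).

If h is the identity on the left of p and has slope 2 on its right, the
commutator [R, h] is the identity on the left of p and R^-1 on its right. Hence
products of such commutators are translation bumps, up to uncontrolled factors
supported in a zone Z away from the bumps. A fixed map moves Z off itself, so
commutators of bumps are short: modulo short elements the bumps form an abelian
group, on which fixed maps act trivially. There the class phi(L) of a bump of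
length L is additive in L, and comparing the square of a bump with a bump
conjugated by the dilation by 2 gives 2 phi(L) = phi(L / 2), hence
3 phi(L / 2) = 0. Thus cubes of bumps are short, R^3 is a bounded product of such
cubes, and the (3 n_K)-th power of the rotation by alpha has length O(K).
Distortion follows by subadditivity of the word length. *)

Set Implicit Arguments.
Unset Strict Implicit.
Unset Printing Implicit Defensive.

Import Order.TTheory GRing.Theory Num.Theory.
Import numFieldNormedType.Exports.

Local Open Scope classical_set_scope.
Local Open Scope ring_scope.
Local Open Scope quotient_scope.

(** * Groups modulo a subgroup *)

(* Locking keeps rewriting with sbijM below from unfolding named products. *)
Fact lock_key : unit. Proof. exact: tt. Qed.

Section ModuloSubgroup.
Variable G : groupType.
Local Open Scope group_scope.

Definition lconj (g x : G) : G := locked_with lock_key (g * x * g^-1).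

Lemma lconjE g x : lconj g x = g * x * g^-1. Proof. by rewrite /lconj; case: lock_key. Qed.

Lemma lconjM g x y : lconj g (x * y) = lconj g x * lconj g y.
Proof. by rewrite !lconjE !mulgA mulgVK. Qed.

Lemma lconjV g x : lconj g x^-1 = (lconj g x)^-1.
Proof. by rewrite !lconjE !invgM invgK !mulgA. Qed.

Lemma lconj_mul g k x : lconj (g * k) x = lconj g (lconj k x).
Proof. by rewrite !lconjE invgM !mulgA. Qed.

Lemma lconj_fix g x : g * x = x * g -> lconj g x = x.
Proof. by rewrite !lconjE => ->; rewrite mulgK. Qed.

Variables U N : G -> Prop.
Hypotheses (U1 : U 1) (UM : forall x y, U x -> U y -> U (x * y))
  (UV : forall x, U x -> U x^-1).
Hypotheses (N1 : N 1) (NM : forall x y, N x -> N y -> N (x * y))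
  (NV : forall x, N x -> N x^-1) (NU : forall x, N x -> U x)
  (NR : forall x y, U x -> U y -> N (x * y * x^-1 * y^-1)).

(** Equality in the quotient of [U] by [N], which is abelian by [NR]. Membership in [U] is part of
    the relation, so that every congruence carries it along. *)
Definition eqmod x y := [/\ U x, U y & N (x * y^-1)].

Lemma eqmod_refl x : U x -> eqmod x x.
Proof. by move=> Ux; split=> //; rewrite mulgV. Qed.

Lemma eqmod_sym x y : eqmod x y -> eqmod y x.
Proof. by case=> Ux Uy /NV; rewrite invgM invgK. Qed.

Lemma eqmod_trans y x z : eqmod x y -> eqmod y z -> eqmod x z.
Proof.
case=> Ux _ Nxy [_ Uz Nyz]; split=> //.
by have := NM Nxy Nyz; rewrite mulgA mulgVK.
Qed.

(** The commutator of [x] and [n] lies in [N]; multiplying it by [n] gives the conjugate. *)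
Lemma normU x n : U x -> N n -> N (x * n * x^-1).
Proof.
move=> Ux Nn; have := NM (NR Ux (NU Nn)) Nn.
by rewrite mulgVK.
Qed.

Lemma eqmodM x x' y y' : eqmod x x' -> eqmod y y' -> eqmod (x * y) (x' * y').
Proof.
case=> Ux Ux' Nx [Uy Uy' Ny]; split; [exact: UM|exact: UM|].
have := NM (normU Ux Ny) Nx.
by rewrite invgM !mulgA mulgVK.
Qed.

Lemma eqmod_conj g x : U g -> U x -> eqmod (lconj g x) x.
Proof.
by move=> Ug Ux; split=> //; [rewrite lconjE; exact: UM (UM Ug Ux) (UV Ug)|rewrite lconjE; exact: NR].
Qed.

Lemma eqmod_divP x y : U x -> U y -> eqmod x y <-> eqmod (x^-1 * y) 1.
Proof.
move=> Ux Uy; split=> [xy|xy].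
  have := eqmodM (eqmod_refl (UV Ux)) (eqmod_sym xy); by rewrite mulVg.
have := eqmodM (eqmod_refl Ux) xy; rewrite mulVKg mulg1; exact: eqmod_sym.
Qed.

Lemma eqmod_cancel x y : U x -> eqmod (x * y) x -> eqmod y 1.
Proof.
move=> Ux xy; have := eqmodM (eqmod_refl (UV Ux)) xy.
by rewrite mulKg mulVg.
Qed.

Lemma eqmod1 x : eqmod x 1 -> N x.
Proof. by case=> _ _; rewrite invg1 mulg1. Qed.

End ModuloSubgroup.

(** * Sequences of bijections of the line *)

Section SequencesOfBijections.
Variable R : realType.

(* Bijections indexed by the step K, so that bounds uniform in K are statements
   about elements of a single group. *)
Record sbij := SBij {
  sbij_fun :> nat -> R -> R;
  sbij_inv : nat -> R -> R;
  sbij_funK : forall K, cancel (sbij_fun K) (sbij_inv K);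
  sbij_invK : forall K, cancel (sbij_inv K) (sbij_fun K) }.

Lemma sbij_eqP (x y : sbij) : (forall K r, x K r = y K r) -> x = y.
Proof.
case: x y => [f f' fK f'K] [g g' gK g'K] /= fg.
have fgE : f = g by apply/funext => K; apply/funext => r.
have fgE' : f' = g'.
  by apply/funext => K; apply/funext => r; rewrite -{1}(g'K K r) -fgE fK.
by subst; congr SBij; exact: Prop_irrelevance.
Qed.

HB.instance Definition _ := gen_eqMixin sbij.
HB.instance Definition _ := gen_choiceMixin sbij.

Definition sbij_one : sbij :=
  @SBij (fun=> idfun) (fun=> idfun) (fun _ _ => erefl) (fun _ _ => erefl).

Definition sbij_opp (x : sbij) : sbij := SBij (@sbij_invK x) (@sbij_funK x).

Definition sbij_mul (x y : sbij) : sbij :=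
  @SBij (fun K => x K \o y K) (fun K => sbij_inv y K \o sbij_inv x K)
    (fun K => can_comp (@sbij_funK x K) (@sbij_funK y K))
    (fun K => can_comp (@sbij_invK y K) (@sbij_invK x K)).

Lemma sbij_mulA : associative sbij_mul.
Proof. by move=> f g h; exact: sbij_eqP. Qed.
Lemma sbij_mul1 : left_id sbij_one sbij_mul.
Proof. by move=> f; exact: sbij_eqP. Qed.
Lemma sbij_mulr1 : right_id sbij_one sbij_mul.
Proof. by move=> f; exact: sbij_eqP. Qed.
Lemma sbij_mulV : left_inverse sbij_one sbij_opp sbij_mul.
Proof. by move=> f; apply: sbij_eqP => K x /=; rewrite sbij_funK. Qed.
Lemma sbij_mulrV : right_inverse sbij_one sbij_opp sbij_mul.
Proof. by move=> f; apply: sbij_eqP => K x /=; rewrite sbij_invK. Qed.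

HB.instance Definition _ := isGroup.Build sbij
  sbij_mulA sbij_mul1 sbij_mulr1 sbij_mulV sbij_mulrV.

Implicit Types (x y g : sbij) (P Q : R -> Prop).

Lemma sbijM x y K r : (x * y)%g K r = x K (y K r). Proof. by []. Qed.
Lemma sbij1 K r : (1%g : sbij) K r = r. Proof. by []. Qed.
Lemma sbijK x K r : (x^-1)%g K (x K r) = r. Proof. exact: sbij_funK. Qed.
Lemma sbijVK x K r : x K ((x^-1)%g K r) = r. Proof. exact: sbij_invK. Qed.

Lemma sbijV_eq x K r s : x K r = s -> (x^-1)%g K s = r.
Proof. by move=> <-; rewrite sbijK. Qed.

Lemma sbij_inj x K : injective (x K).
Proof. exact: can_inj (@sbij_funK x K). Qed.

Definition supp P x := forall K r, ~ P r -> x K r = r.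

Lemma suppM P x y : supp P x -> supp P y -> supp P (x * y)%g.
Proof. by move=> Px Py K r nP; rewrite sbijM Py// Px. Qed.

Lemma suppV P x : supp P x -> supp P (x^-1)%g.
Proof. by move=> Px K r nP; apply: sbijV_eq; exact: Px. Qed.

Lemma supp_sub P Q x : (forall r, P r -> Q r) -> supp P x -> supp Q x.
Proof. by move=> PQ Px K r nQ; apply: Px => /PQ. Qed.

(** If [x K r] left [P] it would be fixed by [x K], hence equal to [r] by injectivity. *)
Lemma supp_stable P x K r : supp P x -> P r -> P (x K r).
Proof.
move=> Px Pr; apply: contrapT => nP; have := Px K _ nP.
by move/sbij_inj => E; apply: nP; rewrite E.
Qed.

Lemma supp_comm P Q x y : (forall r, P r -> ~ Q r) ->
  supp P x -> supp Q y -> (x * y = y * x)%g.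
Proof.
move=> PQ Px Qy; apply: sbij_eqP => K r; rewrite !sbijM.
have [Pr|nPr] := pselect (P r).
  have nQ s : P s -> y K s = s by move=> /PQ; exact: Qy.
  by rewrite !nQ //; exact: supp_stable.
rewrite (Px K r nPr) Px // => Py.
have [Qr|nQr] := pselect (Q r); first case: (PQ _ Py (supp_stable _ Qy Qr)).
by apply: nPr; rewrite -(Qy K r nQr).
Qed.

(** [h^-1 * g] fixes [P] pointwise, so it commutes with [x]. This is how a translation, a dilation
    or [turn] gets replaced by another map that agrees with it on a support only. *)
Lemma lconj_eq_on P g (h : sbij) x : (forall K r, P r -> g K r = h K r) ->
  supp P x -> lconj g x = lconj h x.
Proof.
move=> gh Px; rewrite -[g](mulVKg h) lconj_mul; congr lconj.
apply: lconj_fix; apply: (@supp_comm (fun r => ~ P r) P) => //.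
move=> K r /contrapT Pr; rewrite sbijM gh // sbijK //.
Qed.

Lemma supp_lconj P Q g x : supp P x -> (forall K r, P r -> Q (g K r)) ->
  supp Q (lconj g x).
Proof.
move=> Px PQ K r nQ; rewrite lconjE !sbijM Px ?sbijVK // => Pr.
by apply: nQ; rewrite -(sbijVK g K r); exact: PQ.
Qed.

Definition mono x := forall K, {mono x K : r s / r <= s}.

Lemma monoM x y : mono x -> mono y -> mono (x * y)%g.
Proof. by move=> mx my K r s; rewrite !sbijM mx my. Qed.

Lemma monoV x : mono x -> mono (x^-1)%g.
Proof. by move=> mx K r s; rewrite -(mx K) !sbijVK. Qed.

Definition disp d x := forall K r, `|x K r - r| <= d.

Lemma dispM a b x y : disp a x -> disp b y -> disp (a + b) (x * y)%g.
Proof.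
move=> dx dy K r; rewrite sbijM -(subrKA (y K r)).
by apply: le_trans (ler_normD _ _) _; apply: lerD.
Qed.

Lemma dispV a x : disp a x -> disp a (x^-1)%g.
Proof. by move=> dx K r; rewrite distrC -{1}(sbijVK x K r); exact: dx. Qed.

Lemma disp_bound a x K r : disp a x -> r - a <= x K r <= r + a.
Proof. by move=> /(_ K r); rewrite ler_distl. Qed.

End SequencesOfBijections.

(** * Words and short sequences *)

Section Words.
Variable G : groupType.
Implicit Types (S : set G) (f g : G).
Local Open Scope group_scope.

Inductive word S : nat -> G -> Prop :=
| word0 : word S 0 1
| wordS n f g (e : bool) : S f -> word S n g ->
    word S n.+1 ((if e then f^-1 else f) * g).

Lemma word_gen S f : S f -> word S 1 f.
Proof. by move=> Sf; rewrite -[f]mulg1; exact: (wordS false Sf (word0 S)). Qed.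

Lemma wordM S n m f g : word S n f -> word S m g -> word S (n + m) (f * g).
Proof.
move=> Wf Wg; elim: Wf => [|k a b e Sa _ IH]; first by rewrite mul1g.
by rewrite -mulgA addSn; exact: wordS.
Qed.

Lemma wordV S n g : word S n g -> word S n g^-1.
Proof.
elim=> [|k a b e Sa _ IH]; first by rewrite invg1; exact: word0.
rewrite invgM -addn1; apply: wordM => //.
have := wordS (~~ e) Sa (word0 S); rewrite mulg1.
by case: e => /=; rewrite ?invgK.
Qed.

Lemma word_sub S S' n g : S `<=` S' -> word S n g -> word S' n g.
Proof.
move=> SS'; elim=> [|k a b e /SS' Sa _ IH]; [exact: word0|exact: wordS].
Qed.

Lemma wordX S f n : S f -> word S n (f ^+ n).
Proof.
move=> Sf; elim: n => [|n IH]; first exact: word0.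
by rewrite expgS -add1n; apply: wordM IH; exact: word_gen.
Qed.

Lemma word_prod S n g : word S n g ->
  exists (f : 'I_n -> G) (e : 'I_n -> bool), (forall i, S (f i)) /\
    g = \prod_(i < n) (if e i then (f i)^-1 else f i).
Proof.
elim=> [|k a b e0 Sa _ [f [e [Sf ->]]]].
  by exists (fun=> 1), (fun=> true); split=> [[]//|]; rewrite big_ord0.
exists (fun i => if unlift ord0 i is Some j then f j else a),
  (fun i => if unlift ord0 i is Some j then e j else e0); split.
  by move=> i; case: unliftP => [j _|_].
rewrite big_ord_recl unlift_none; congr (_ * _).
by apply: eq_bigr => i _; rewrite liftK.
Qed.

End Words.

(** * Sequences whose word length grows at most linearly *)

Section Short.
Variable R : realType.
Variable H : set (homeo (circle R)).
Hypotheses (H1 : H 1%g) (HM : forall f g, H f -> H g -> H (f * g)%g)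
  (HV : forall f, H f -> H f^-1%g).
Implicit Types (x y X Y : sbij R) (K : nat) (r s : R).

Definition periodic x := forall K r, x K (r + 1) = x K r + 1.

Lemma periodicM x y : periodic x -> periodic y -> periodic (x * y)%g.
Proof. by move=> px py K r; rewrite !sbijM py px. Qed.

Lemma periodicV x : periodic x -> periodic x^-1%g.
Proof. by move=> px K r; apply: sbijV_eq; rewrite px sbijVK. Qed.

Lemma add1_int (A : R -> R) r (m : int) : (forall s, A (s + 1) = A s + 1) ->
  A (r + m%:~R) = A r + m%:~R.
Proof.
move=> A1; have nat_case (n : nat) s : A (s + n%:R) = A s + n%:R.
  by elim: n => [|n IH]; rewrite ?addr0 // -natr1 !addrA A1 IH.
case: m => n; first exact: nat_case.
rewrite NegzE mulrNz; apply: (addIr n.+1%:R).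
by rewrite -nat_case !subrK.
Qed.

Lemma periodic_int x K r (m : int) : periodic x ->
  x K (r + m%:~R) = x K r + m%:~R.
Proof. by move=> px; exact: add1_int. Qed.

Lemma is_liftM (f g : homeo (circle R)) x y K : is_lift f (x K) ->
  is_lift g (y K) -> is_lift (f * g)%g ((x * y)%g K).
Proof. by move=> fx gy r; rewrite /= gy fx. Qed.

Lemma is_liftV (f : homeo (circle R)) x K :
  is_lift f (x K) -> is_lift f^-1%g (x^-1%g K).
Proof. by move=> fx r; rewrite -[in LHS](sbijVK x K r) -fx /= homeo_funK. Qed.

(** One finite set [S] and one constant [C] serve all [K]. The bound uses [K.+1] so that at [K = 0]
    a nonempty word is still allowed. *)
Definition short X := periodic X /\
  exists S : set (homeo (circle R)), [/\ finite_set S, S `<=` H &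
    exists C : nat, forall K, exists n g,
      [/\ (n <= C * K.+1)%N, word S n g & is_lift g (X K)]].

Lemma shortM X Y : short X -> short Y -> short (X * Y)%g.
Proof.
move=> [pX [S [fS SH [C XC]]]] [pY [S' [fS' SH' [C' YC]]]].
split; first exact: periodicM.
exists (S `|` S'); split; [by rewrite finite_setU|by move=> f [/SH|/SH']|].
exists (C + C')%N => K.
have [n [g [nC Wg gX]]] := XC K; have [m [g' [mC Wg' gY]]] := YC K.
exists (n + m)%N, (g * g')%g; split; first by rewrite mulnDl leq_add.
  apply: wordM; first by apply: word_sub Wg; exact: subsetUl.
  by apply: word_sub Wg'; exact: subsetUr.
exact: is_liftM.
Qed.

Lemma shortV X : short X -> short X^-1%g.
Proof.
move=> [pX [S [fS SH [C XC]]]]; split; first exact: periodicV.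
exists S; split=> //; exists C => K.
have [n [g [nC Wg gX]]] := XC K.
by exists n, g^-1%g; split=> //; [exact: wordV|exact: is_liftV].
Qed.

Lemma short_const g X : H g -> periodic X -> (forall K, is_lift g (X K)) ->
  short X.
Proof.
move=> Hg pX gX; split=> //; exists [set g]; split.
- exact: finite_set1.
- by move=> _ ->.
- exists 1%N => K; exists 1%N, g; split=> //.
  exact: word_gen.
Qed.

Lemma short1 : short 1%g.
Proof. by apply: (short_const H1). Qed.

(** [X] is the identity between consecutive translates of [[a, b]], so the agreement with [x] on one
    period extends up to the neighbouring translates of the support. *)
Lemma periodic_ext x X a b K r : 0 <= a -> a <= b -> b < 1 ->
  supp (fun s => a <= s <= b) x -> periodic X ->
  (forall K s, 0 <= s < 1 -> X K s = x K s) ->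
  b - 1 < r -> r < a + 1 -> X K r = x K r.
Proof.
move=> a0 ab b1 sx pX Xx br ra.
have out s : s < a \/ b < s -> x K s = s.
  by move=> sab; apply: sx => /andP[a_s s_b]; case: sab; rewrite ltNge ?a_s ?s_b.
have [r0|r0] := ltP r 0.
  apply: (addIr 1); rewrite -pX Xx; last by apply/andP; split; lra.
  by rewrite !out //; [left|right]; lra.
have [r1|r1] := ltP r 1; first by rewrite Xx // r0.
rewrite -[in LHS](subrK 1 r) pX Xx; last by apply/andP; split; lra.
by rewrite !out ?subrK//; [right|left]; lra.
Qed.

Definition in01 r : Prop := 0 <= r < 1.

(** The passage between line and circle: [x] lives in one fundamental domain, and [X] is its
    periodic extension. Supports and commutation can thus be studied on the line. *)
Definition line_short x := supp in01 x /\
  exists2 X, short X & forall K r, in01 r -> X K r = x K r.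

Lemma line_short1 : line_short 1%g.
Proof. by split=> //; exists 1%g => //; exact: short1. Qed.

Lemma line_shortM x y : line_short x -> line_short y -> line_short (x * y)%g.
Proof.
move=> [sx [X EX Xx]] [sy [Y EY Yy]]; split; first exact: suppM.
exists (X * Y)%g; first exact: shortM.
by move=> K r r01; rewrite !sbijM Yy // Xx //; exact: supp_stable.
Qed.

Lemma line_shortV x : line_short x -> line_short x^-1%g.
Proof.
move=> [sx [X EX Xx]]; split; first exact: suppV.
exists X^-1%g; first exact: shortV.
move=> K r r01; apply: sbijV_eq; rewrite Xx ?sbijVK //.
by apply: supp_stable; first exact: suppV.
Qed.

Lemma small_int (m : int) : -1 < m%:~R :> R -> m%:~R < 1 :> R -> m = 0.
Proof.
move=> m1 m2; have : (-1)%:~R < m%:~R :> R by [].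
have : m%:~R < 1%:~R :> R by [].
by rewrite !ltr_int; lia.
Qed.

End Short.

(** * Translation bumps and short rotations *)

Section Line.
Variable R : realType.
Implicit Types (p q c r s : R) (K : nat) (x y : sbij R).

Definition const_sbij (F G : R -> R) (FK : cancel F G) (GK : cancel G F) : sbij R :=
  @SBij R (fun=> F) (fun=> G) (fun=> FK) (fun=> GK).

Definition Tr s : sbij R := const_sbij (addrK s) (addrNK s).

Lemma TrE s K r : Tr s K r = r + s. Proof. by []. Qed.

Lemma TrD s t : (Tr s * Tr t)%g = Tr (s + t).
Proof. by apply: sbij_eqP => K r; rewrite sbijM !TrE; lra. Qed.

Lemma TrV s : (Tr s)^-1%g = Tr (- s).
Proof. by apply: sbij_eqP => K r; apply: sbijV_eq; rewrite !TrE; lra. Qed.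

(** [eta] bounds both the angles [beta K] and the width of the zone where [h] is not affine. Since
    it is at most 1/2000, errors such as [18 * eta] stay below the hundredths in which all intervals
    below are given. *)
Variable eta : R.
Hypotheses (eta_gt0 : 0 < eta) (eta_le : 40 * (50 * eta) <= 1).
Variables h hi : R -> R.
Hypotheses (hK : cancel h hi) (hiK : cancel hi h).
Hypotheses (h_mono : {mono h : x y / x <= y})
  (h_le0 : forall r, r <= 0 -> h r = r)
  (h_ge : forall r, eta <= r -> h r = 2 * r).

Ltac elra := have ? := eta_gt0; have ? := eta_le; lra.

Definition hp p : sbij R := locked_with lock_key
  (lconj (Tr p) (const_sbij hK hiK)).

Lemma hp_def p : hp p =
  lconj (Tr p) (const_sbij hK hiK).
Proof. by rewrite /hp; case: lock_key. Qed.

Lemma hpE p K r : hp p K r = h (r - p) + p.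
Proof. by rewrite !hp_def lconjE TrV !sbijM. Qed.

Lemma lconj_Tr_hp s p : lconj (Tr s) (hp p) = hp (p + s).
Proof. by rewrite !hp_def -lconj_mul TrD addrC. Qed.

Lemma hp_le p K r : r <= p -> hp p K r = r.
Proof. by move=> rp; rewrite hpE h_le0 ?subrK// subr_le0. Qed.

Lemma hp_ge p K r : p + eta <= r -> hp p K r = 2 * r - p.
Proof. by move=> rp; rewrite hpE h_ge; elra. Qed.

Lemma hpV_le p K r : r <= p -> (hp p)^-1%g K r = r.
Proof. by move=> rp; apply: sbijV_eq; rewrite hp_le. Qed.

Lemma hpV_ge p K r : p + 2 * eta <= r -> (hp p)^-1%g K r = (r + p) / 2.
Proof. by move=> rp; apply: sbijV_eq; rewrite hp_ge; elra. Qed.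

Lemma mono_hp p : mono (hp p).
Proof. by move=> K r s; rewrite !hpE lerD2r h_mono lerD2r. Qed.

(* Slope 2 from p until the image reaches c, then slope 1/2 until the diagonal
   is met at (3c - p)/2. *)
Definition bump p c : sbij R := locked_with lock_key
  (hp ((3 * c - p) / 2) * (hp c)^-1 * (hp c)^-1 * hp p)%g.

Lemma bump_def p c : bump p c =
  (hp ((3 * c - p) / 2) * (hp c)^-1 * (hp c)^-1 * hp p)%g.
Proof. by rewrite /bump; case: lock_key. Qed.

Lemma mono_bump p c : mono (bump p c).
Proof.
rewrite bump_def; apply: monoM; last exact: mono_hp.
by do 2!(apply: monoM; last by apply: monoV; exact: mono_hp); exact: mono_hp.
Qed.

(** Up to [c] the other factors do nothing, because [c <= (3 * c - p) / 2]. *)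
Lemma bump_slope p c K r : p <= c -> hp p K r <= c -> bump p c K r = hp p K r.
Proof.
move=> pc rc; rewrite !bump_def !sbijM.
by rewrite (hpV_le _ rc) (hpV_le _ rc) hp_le //; elra.
Qed.

Lemma bump_le p c K r : p <= c -> r <= p -> bump p c K r = r.
Proof. by move=> pc rp; rewrite bump_slope// hp_le //; elra. Qed.

Lemma bump_dbl p c K r : p + eta <= r -> 2 * r - p <= c ->
  bump p c K r = 2 * r - p.
Proof. by move=> *; rewrite bump_slope ?hp_ge //; elra. Qed.

Lemma bump_ge p c K r : p + 2 * eta <= c -> (3 * c - p) / 2 + 2 * eta <= r ->
  bump p c K r = r.
Proof.
move=> pc rc; rewrite !bump_def !sbijM (@hp_ge p); last by elra.
rewrite (@hpV_ge c K (2 * r - p)); last by elra.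
rewrite hpV_ge; last by elra.
by rewrite hp_ge; elra.
Qed.

Lemma bumpV_slope p c K r : p <= c -> r <= c ->
  (bump p c)^-1%g K r = (hp p)^-1%g K r.
Proof. by move=> pc rc; apply: sbijV_eq; rewrite bump_slope ?sbijVK. Qed.

Lemma bumpV_half p c K r : p + 2 * eta <= r -> r <= c ->
  (bump p c)^-1%g K r = (r + p) / 2.
Proof. by move=> pr rc; rewrite bumpV_slope ?hpV_ge //; elra. Qed.

Lemma supp_bump p c a b : p + 2 * eta <= c -> a <= p ->
  (3 * c - p) / 2 + 2 * eta <= b -> supp (fun r => a <= r <= b) (bump p c).
Proof.
move=> pc ap cb K r /negP; rewrite negb_and -!ltNge => /orP[ra|br].
  by rewrite bump_le //; elra.
by rewrite bump_ge //; elra.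
Qed.

(** Halving the distance to [b] and then doubling the distance to [b - s] is the translation by [s]:
    a map independent of [K], of compact support, that moves an interval rigidly. *)
Definition shift_bump b s c : sbij R := locked_with lock_key
  (bump (b - s) (c + s) * (bump b c)^-1)%g.

Lemma shift_bump_def b s c : shift_bump b s c =
  (bump (b - s) (c + s) * (bump b c)^-1)%g.
Proof. by rewrite /shift_bump; case: lock_key. Qed.

Lemma shift_bump_le b s c K r : 0 <= s -> b <= c -> r <= b - s ->
  shift_bump b s c K r = r.
Proof.
move=> s0 bc rb; rewrite shift_bump_def sbijM bumpV_slope ?hpV_le ?bump_le //; elra.
Qed.

Lemma shift_bump_mid b s c K r : 0 <= s -> b + 2 * eta <= r -> r <= c ->
  shift_bump b s c K r = r + s.
Proof. by move=> s0 br rc; rewrite shift_bump_def sbijM bumpV_half// bump_dbl //; elra. Qed.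

Lemma supp_shift_bump b s c a d : 0 <= s -> b + 2 * eta <= c -> a <= b - s ->
  (3 * c - b) / 2 + 2 * s + 2 * eta <= d ->
  supp (fun r => a <= r <= d) (shift_bump b s c).
Proof.
move=> s0 bc ab cd; rewrite shift_bump_def; apply: suppM; first by apply: supp_bump; elra.
by apply: suppV; apply: supp_bump; elra.
Qed.

Variable beta : nat -> R.
Hypothesis beta_le : forall K, - eta <= beta K <= eta.

Definition turn : sbij R :=
  @SBij R (fun K => +%R^~ (beta K)) (fun K => +%R^~ (- beta K))
    (fun K => addrK (beta K)) (fun K => addrNK (beta K)).

Lemma turnE K r : turn K r = r + beta K. Proof. by []. Qed.
Lemma turnVE K r : turn^-1%g K r = r - beta K. Proof. by []. Qed.

Lemma turn_Tr s : (Tr s * turn = turn * Tr s)%g.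
Proof. by apply: sbij_eqP => K r; rewrite !sbijM !turnE !TrE; elra. Qed.

Lemma mono_turn : mono turn.
Proof. by move=> K r s; rewrite !turnE lerD2r. Qed.

Ltac bound K := have := beta_le K; move=> /andP[? ?].

(* A clean half-infinite translation: the identity left of p, and turn^-1 right
   of p, up to a transition zone of size O(eta). *)
Definition ht p : sbij R := locked_with lock_key
  (lconj turn (hp p) * (hp p)^-1)%g.

Lemma ht_def p : ht p =
  (lconj turn (hp p) * (hp p)^-1)%g.
Proof. by rewrite /ht; case: lock_key. Qed.

Lemma htE p K r : ht p K r = hp p K ((hp p)^-1%g K r - beta K) + beta K.
Proof. by rewrite !ht_def lconjE !sbijM. Qed.

Lemma ht_le p K r : r <= p - eta -> ht p K r = r.
Proof.
bound K => rp; rewrite htE hpV_le; last by elra.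
by rewrite hp_le; elra.
Qed.

Lemma ht_ge p K r : p + 4 * eta <= r -> ht p K r = r - beta K.
Proof.
bound K => rp; rewrite htE hpV_ge; last by elra.
by rewrite hp_ge; elra.
Qed.

Lemma htV_le p K r : r <= p - eta -> (ht p)^-1%g K r = r.
Proof. by move=> rp; apply: sbijV_eq; rewrite ht_le. Qed.

Lemma htV_ge p K r : p + 5 * eta <= r -> (ht p)^-1%g K r = r + beta K.
Proof. by bound K => rp; apply: sbijV_eq; rewrite ht_ge; elra. Qed.

Lemma mono_ht p : mono (ht p).
Proof.
rewrite ht_def; apply: monoM; last by apply: monoV; exact: mono_hp.
rewrite lconjE; apply: monoM; last by apply: monoV; exact: mono_turn.
by apply: monoM; [exact: mono_turn|exact: mono_hp].
Qed.

(** Outside the transition zone the displacement is 0 or [- beta K]. Inside, monotonicity traps both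
    [r] and its image in [[p - eta, p + 5 * eta]]. *)
Lemma disp_ht p : disp (6 * eta) (ht p).
Proof.
move=> K r; bound K; rewrite ler_norml.
have [rp|rp] := leP r (p - eta); first by rewrite ht_le // subrr; elra.
have [pr|pr] := leP (p + 4 * eta) r; first by rewrite ht_ge //; elra.
have : p - eta <= ht p K r <= p + 5 * eta.
  rewrite -{1}(@ht_le p K (p - eta)) // mono_ht (ltW rp) /=.
  apply: le_trans (_ : ht p K (p + 4 * eta) <= _); first by rewrite mono_ht ltW.
  by rewrite ht_ge; elra.
by elra.
Qed.

Lemma lconj_Tr_ht s p : lconj (Tr s) (ht p) = ht (p + s).
Proof.
by rewrite !ht_def lconjM lconjV -lconj_mul turn_Tr lconj_mul !lconj_Tr_hp.
Qed.

Definition dl s : sbij R.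
Proof.
apply: (@const_sbij (fun r => 2 * r - s) (fun r => (r + s) / 2)) => r; elra.
Defined.

Lemma dlE s K r : dl s K r = 2 * r - s. Proof. by []. Qed.
Lemma dlVE s K r : (dl s)^-1%g K r = (r + s) / 2. Proof. by []. Qed.

(* As ht, but with doubled displacement. The fixed point 10^-1 of the dilation is
   that of the slope 2 part of bump 10^-1 (25 / 100), which realizes it. *)
Definition t2 p : sbij R := locked_with lock_key
  (lconj (dl 10^-1) (ht ((p + 10^-1) / 2))).

Lemma t2_def p : t2 p =
  lconj (dl 10^-1) (ht ((p + 10^-1) / 2)).
Proof. by rewrite /t2; case: lock_key. Qed.

Lemma t2E p K r : t2 p K r = 2 * ht ((p + 10^-1) / 2) K ((r + 10^-1) / 2) - 10^-1.
Proof. by rewrite !t2_def lconjE !sbijM dlE dlVE. Qed.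

Lemma t2_le p K r : r <= p - 2 * eta -> t2 p K r = r.
Proof. by move=> rp; rewrite t2E ht_le; elra. Qed.

Lemma t2_ge p K r : p + 8 * eta <= r -> t2 p K r = r - 2 * beta K.
Proof. by move=> rp; rewrite t2E ht_ge; elra. Qed.

Lemma lconj_Tr_t2 s p : lconj (Tr s) (t2 p) = t2 (p + s).
Proof.
rewrite !t2_def -lconj_mul.
have -> : (Tr s * dl 10^-1)%g = (dl 10^-1 * Tr (s / 2))%g.
  by apply: sbij_eqP => K r; rewrite !sbijM !dlE !TrE; elra.
by rewrite lconj_mul lconj_Tr_ht; congr (lconj _ (ht _)); elra.
Qed.

Definition aa p : sbij R := locked_with lock_key
  ((ht p)^-1 * (ht p)^-1 * t2 p)%g.

Lemma aa_def p : aa p =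
  ((ht p)^-1 * (ht p)^-1 * t2 p)%g.
Proof. by rewrite /aa; case: lock_key. Qed.

Lemma lconj_Tr_aa s p : lconj (Tr s) (aa p) = aa (p + s).
Proof. by rewrite !aa_def !lconjM !lconjV lconj_Tr_t2 lconj_Tr_ht. Qed.

Lemma supp_aa p : supp (fun r => p - 2 * eta <= r <= p + 10 * eta) (aa p).
Proof.
move=> K r /negP; bound K; rewrite negb_and -!ltNge aa_def !sbijM => /orP[rp|rp].
  rewrite t2_le; last by elra.
  by rewrite !htV_le; elra.
rewrite t2_ge; last by elra.
rewrite (@htV_ge p K (r - 2 * beta K)); last by elra.
by rewrite htV_ge; elra.
Qed.

(* Translation bump: turn^-1 between p and q, the identity outside. *)
Definition uu p q : sbij R := locked_with lock_key
  (ht p * (ht q)^-1)%g.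

Lemma uu_def p q : uu p q =
  (ht p * (ht q)^-1)%g.
Proof. by rewrite /uu; case: lock_key. Qed.

Lemma supp_uu p q : p <= q ->
  supp (fun r => p - eta <= r <= q + 5 * eta) (uu p q).
Proof.
move=> pq K r /negP; bound K; rewrite negb_and -!ltNge uu_def !sbijM => /orP[rp|rp].
  by rewrite htV_le ?ht_le; elra.
by rewrite htV_ge ?ht_ge; elra.
Qed.

Lemma uu_chain p q s : (uu p q * uu q s)%g = uu p s.
Proof. by rewrite !uu_def mulgA mulgVK. Qed.

Lemma lconj_Tr_uu s p q : lconj (Tr s) (uu p q) = uu (p + s) (q + s).
Proof. by rewrite !uu_def lconjM lconjV !lconj_Tr_ht. Qed.

Definition hc p : sbij R := locked_with lock_key (ht p * ht p * ht p)%g.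

Lemma hc_def p : hc p = (ht p * ht p * ht p)%g.
Proof. by rewrite /hc; case: lock_key. Qed.

(** * Cubes of translation bumps are short *)

Section Core.

(** [EL] stands for [line_short H]; the hypotheses list what the argument takes from it. *)
Variable EL : sbij R -> Prop.
Hypotheses (EL1 : EL 1%g) (ELM : forall x y, EL x -> EL y -> EL (x * y)%g)
  (ELV : forall x, EL x -> EL x^-1%g).
Hypothesis EL_bump : forall p c, 1 / 100 <= p -> p + 2 * eta <= c ->
  (3 * c - p) / 2 + 2 * eta <= 99 / 100 -> EL (bump p c).
Hypothesis EL_conj_turn : forall p, 1 / 10 <= p -> p <= 3 / 10 ->
  EL (lconj turn (bump p (43 / 100))).

Let inA r : Prop := 3 / 100 <= r <= 40 / 100.
Let inZ r : Prop := 42 / 100 <= r <= 64 / 100.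

Definition short_inA x := supp inA x /\ EL x.

(* Elements supported in A that become short after multiplication by some
   uncontrolled element supported in Z. *)
Definition nearly_short x := supp inA x /\ exists2 b, supp inZ b & EL (x * b)%g.

Lemma inAZ r : inA r -> ~ inZ r.
Proof. by rewrite /inA /inZ => /andP[? ?] /andP[? ?]; suff : r < r; [by rewrite ltxx|lra]. Qed.

Lemma EA1 : short_inA 1%g. Proof. by []. Qed.

Lemma EAM x y : short_inA x -> short_inA y -> short_inA (x * y)%g.
Proof. by move=> [xA Ex] [yA Ey]; split; [exact: suppM|exact: ELM]. Qed.

Lemma EAV x : short_inA x -> short_inA x^-1%g.
Proof. by move=> [xA Ex]; split; [exact: suppV|exact: ELV]. Qed.

Lemma EAU x : short_inA x -> nearly_short x.
Proof. by move=> [xA Ex]; split=> //; exists 1%g => //; rewrite mulg1. Qed.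

Lemma U1 : nearly_short 1%g. Proof. exact/EAU/EA1. Qed.

Lemma UM x y : nearly_short x -> nearly_short y -> nearly_short (x * y)%g.
Proof.
move=> [xA [b bZ Exb]] [yA [c cZ Eyc]]; split; first exact: suppM.
exists (b * c)%g; first exact: suppM.
have := ELM Exb Eyc.
by rewrite !mulgA -(mulgA x b) -(supp_comm inAZ yA bZ) !mulgA.
Qed.

Lemma UV x : nearly_short x -> nearly_short x^-1%g.
Proof.
move=> [xA [b bZ Exb]]; split; first exact: suppV.
exists b^-1%g; first exact: suppV.
by rewrite -invgM -(supp_comm inAZ xA bZ); exact: ELV.
Qed.

(** Each factor doubles the distance to 40/100, so 42/100 goes to 44, 48, 56 and finally 72
    hundredths, beyond the end 64/100 of Z, while A is fixed. *)
Let f := (bump (40 / 100) (78 / 100) ^+ 4)%g.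

Lemma f_le K r : r <= 40 / 100 -> f K r = r.
Proof. by move=> r40; rewrite /f !expgS expg0 !sbijM !bump_le //; elra. Qed.

Lemma f_ge K r : 42 / 100 <= r -> 72 / 100 <= f K r.
Proof.
move=> r42; have mf : mono f.
  by rewrite /f !expgS expg0 mulg1; do 3?[apply: monoM]; exact: mono_bump.
have <- : f K (42 / 100) = 72 / 100.
  rewrite /f !expgS expg0 !sbijM sbij1.
  have E a b : 41 / 100 <= a -> a <= 59 / 100 -> b = 2 * a - 40 / 100 ->
      bump (40 / 100) (78 / 100) K a = b.
    by move=> *; rewrite bump_dbl //; elra.
  rewrite (E (42 / 100) (44 / 100)); [|lra..].
  rewrite (E (44 / 100) (48 / 100)); [|lra..].
  rewrite (E (48 / 100) (56 / 100)); [|lra..].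
  by apply: E; lra.
by rewrite mf.
Qed.

Lemma EL_f : EL f.
Proof.
have Eb : EL (bump (40 / 100) (78 / 100)) by apply: EL_bump; elra.
by rewrite /f !expgS expg0 mulg1; do 3?[apply: ELM].
Qed.

(* f pushes Z off itself, so that the uncontrolled factors can be made to
   commute. *)
Lemma UR x y : nearly_short x -> nearly_short y -> short_inA (x * y * x^-1 * y^-1)%g.
Proof.
move=> [xA [b bZ Exb]] [yA [c cZ Eyc]]; split.
  by do 3?[apply: suppM => //]; exact: suppV.
pose inF r : Prop := 40 / 100 < r.
pose inZ' r : Prop := 72 / 100 <= r.
have fF : supp inF f by move=> K r /negP; rewrite -leNgt => /f_le.
have AF r : inA r -> ~ inF r by rewrite /inA /inF => /andP[? ?] ?; suff : r < r; [by rewrite ltxx|lra].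
have AZ' r : inA r -> ~ inZ' r by rewrite /inA /inZ' => /andP[? ?] ?; suff : r < r; [by rewrite ltxx|lra].
have ZZ' r : inZ r -> ~ inZ' r by rewrite /inZ /inZ' => /andP[? ?] ?; suff : r < r; [by rewrite ltxx|lra].
have c'Z : supp inZ' (lconj f c).
  by apply: (supp_lconj cZ) => K r /andP[Zr _]; exact: f_ge.
have E' : EL (y * lconj f c)%g.
  have <- : lconj f (y * c)%g = (y * lconj f c)%g.
    by rewrite lconjM (@lconj_fix _ f y) // (supp_comm AF yA fF).
  by rewrite lconjE; exact: ELM (ELM EL_f Eyc) (ELV EL_f).
set c' := lconj f c in c'Z E'.
(* In the commutator of [x * b] and [y * c'], the factors [b] and [c'] commute with each other and
   with [x] and [y], so they cancel. *)
have := ELM (ELM Exb E') (ELV (ELM E' Exb)).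
have -> : (x * b * (y * c') = x * y * (b * c'))%g.
  by rewrite !mulgA -(mulgA x b) -(supp_comm inAZ yA bZ) !mulgA.
have -> : (y * c' * (x * b) = y * x * (b * c'))%g.
  rewrite !mulgA -(mulgA y c') -(supp_comm AZ' xA c'Z) !mulgA.
  by rewrite -(mulgA _ c' b) -(supp_comm ZZ' bZ c'Z) !mulgA.
by rewrite mulgKA invgM mulgA.
Qed.

Let eqm := eqmod nearly_short short_inA.
Let eqm_refl := @eqmod_refl _ nearly_short _ EA1.

Let eT := @eqmod_trans _ nearly_short _ EAM.
Let eS := @eqmod_sym _ nearly_short _ EAV.
Let eMl := eqmodM UM EAM EAU UR.
Let eC := eqmod_conj UM UV UR.

(** The compactly supported version of [ht p], with a bump in place of [hp p]. The two agree to the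
    left of Z, and the return of the bump to the diagonal is felt only inside Z. *)
Definition bumped p : sbij R := locked_with lock_key
  (lconj turn (bump p (43 / 100)) * (bump p (43 / 100))^-1)%g.

Lemma bumped_def p : bumped p =
  (lconj turn (bump p (43 / 100)) * (bump p (43 / 100))^-1)%g.
Proof. by rewrite /bumped; case: lock_key. Qed.

Lemma bumpedE p K r : 1 / 10 <= p -> p <= 3 / 10 -> r <= 42 / 100 + 6 * eta ->
  bumped p K r = ht p K r.
Proof.
bound K => p1 p3 rp.
rewrite bumped_def lconjE !sbijM bumpV_slope; [|elra..].
have /andP[_ E] := disp_bound K r (@disp_ht p).
rewrite bump_slope ?htE//; first by elra.
by move: E; rewrite htE turnVE; elra.
Qed.

Lemma bumped_ge p K r : 1 / 10 <= p -> p <= 3 / 10 -> 62 / 100 <= r ->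
  bumped p K r = r.
Proof.
bound K => p1 p3 rp.
have E s : 61 / 100 <= s -> bump p (43 / 100) K s = s.
  by move=> s6; rewrite bump_ge //; elra.
rewrite bumped_def lconjE !sbijM (sbijV_eq (E _ _)); last by elra.
by rewrite turnVE E ?turnE ?subrK //; elra.
Qed.

Lemma EL_bumped p : 1 / 10 <= p -> p <= 3 / 10 -> EL (bumped p).
Proof.
move=> p1 p3; rewrite bumped_def; apply: ELM; first exact: EL_conj_turn.
by apply/ELV/EL_bump; elra.
Qed.

(** The short element [bumped p * (bumped q)^-1] coincides with [uu p q] off Z, so their quotient is
    an admissible uncontrolled factor. *)
Lemma U_uu p q : 1 / 10 <= p -> p <= q -> q <= 3 / 10 -> nearly_short (uu p q).
Proof.
move=> p1 pq q3; split.
  apply: supp_sub (supp_uu pq) => r /andP[? ?]; rewrite /inA.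
  by apply/andP; split; elra.
exists ((uu p q)^-1 * (bumped p * (bumped q)^-1))%g; last first.
  by rewrite mulVKg; apply: ELM; [|apply: ELV]; apply: EL_bumped; lra.
move=> K r; rewrite /inZ => /negP; rewrite negb_and -!ltNge => /orP[r42|r64].
  rewrite !sbijM; apply: sbijV_eq; rewrite uu_def sbijM.
  have /andP[_ E] := disp_bound K r (dispV (@disp_ht q)).
  rewrite (@sbijV_eq _ (bumped q) K ((ht q)^-1%g K r)).
    by rewrite bumpedE//; elra.
  by rewrite bumpedE ?sbijVK//; elra.
rewrite !sbijM; apply: sbijV_eq.
rewrite (supp_uu pq); last by move=> /andP[_]; rewrite leNgt => /negP; apply; elra.
rewrite (@sbijV_eq _ (bumped q) K r) ?bumped_ge //; lra.
Qed.

Lemma EA_shift_bump b s c : 0 <= s -> b + 2 * eta <= c -> 3 / 100 <= b - s ->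
  (3 * c - b) / 2 + 2 * s + 2 * eta <= 40 / 100 -> short_inA (shift_bump b s c).
Proof.
move=> s0 bc bs cb; split; first by apply: supp_shift_bump.
rewrite shift_bump_def; apply: ELM; first by apply: EL_bump; elra.
by apply/ELV/EL_bump; elra.
Qed.

(** On the support of [uu p q] the translation by [s] is realized by a [shift_bump], and conjugation
    by it is trivial in the abelian quotient. Hence the class of a bump depends on its length alone,
    within the stated ranges. *)
Lemma uu_shift p q s : 1 / 10 <= p -> p <= q -> 0 <= s -> q + s <= 3 / 10 ->
  s + 4 / 100 <= p -> (3 * q - p) / 2 + 2 * s + 3 / 100 <= 40 / 100 ->
  eqm (uu (p + s) (q + s)) (uu p q).
Proof.
move=> p1 pq s0 q3 sp qs.
rewrite -lconj_Tr_uu.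
have Ub : nearly_short (shift_bump (p - 1 / 100) s (q + 1 / 100)).
  by apply/EAU/EA_shift_bump; elra.
rewrite -(@lconj_eq_on _ _ (shift_bump (p - 1 / 100) s (q + 1 / 100)) _ _ _
  (supp_uu pq)); first by apply: eC => //; apply: U_uu; lra.
by move=> K r /andP[? ?]; rewrite shift_bump_mid //; elra.
Qed.

(** A bump of doubled displacement is the image under the dilation of an ordinary bump of half the
    length, and [bump 10^-1 (25 / 100)] realizes this dilation on the support. *)
Lemma t2_uu p q : 12 / 100 <= p -> p <= q -> q <= 24 / 100 ->
  eqm (t2 p * (t2 q)^-1)%g (uu ((p + 10^-1) / 2) ((q + 10^-1) / 2)).
Proof.
move=> p1 pq q2.
have pq' : (p + 10^-1) / 2 <= (q + 10^-1) / 2 by lra.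
have -> : (t2 p * (t2 q)^-1)%g =
    lconj (dl 10^-1) (uu ((p + 10^-1) / 2) ((q + 10^-1) / 2)).
  by rewrite !t2_def uu_def lconjM lconjV.
have Eb : short_inA (bump 10^-1 (25 / 100)).
  by split; [apply: supp_bump; elra|apply: EL_bump; elra].
rewrite -(@lconj_eq_on _ _ (bump 10^-1 (25 / 100)) _ _ _ (supp_uu pq')).
  by apply: eC; [exact: EAU|apply: U_uu; lra].
by move=> K r /andP[? ?]; rewrite bump_dbl //; elra.
Qed.

(* Left of s, the compactly supported uu q s acts as ht q. *)
Lemma lconj_uu q s m x : supp (fun r => r <= m) x -> m <= s - eta ->
  lconj (uu q s) x = lconj (ht q) x.
Proof.
move=> xm ms; apply: (lconj_eq_on _ xm) => K r rm.
by rewrite uu_def sbijM htV_le //; lra.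
Qed.

Lemma supp_conj_ht q m x : supp (fun r => r <= m) x ->
  supp (fun r => r <= m + 6 * eta) (lconj (ht q) x).
Proof.
move=> xm; apply: (supp_lconj xm) => K r rm.
by have /andP[_ E] := disp_bound K r (@disp_ht q); lra.
Qed.

Lemma lconj_uu2 q s m x : supp (fun r => r <= m) x -> m + 6 * eta <= s - eta ->
  lconj (uu q s * uu q s)%g x = lconj (ht q * ht q)%g x.
Proof.
move=> xm ms; rewrite !lconj_mul (lconj_uu _ xm); last by elra.
by apply: lconj_uu; [exact: supp_conj_ht xm|].
Qed.

Lemma supp_uu_le p q : p <= q -> supp (fun r => r <= q + 5 * eta) (uu p q).
Proof. by move=> pq; apply: supp_sub (supp_uu pq) => r /andP[]. Qed.

(** The left side is [uu p q] times its conjugate by [ht q]. That conjugator has no compact support,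
    but [uu q s] acts in the same way on [uu p q]. *)
Lemma ht_sqr p q s : 1 / 10 <= p -> p <= q -> q + 1 / 100 <= s -> s <= 3 / 10 ->
  eqm (ht p * ht p * (ht q)^-1 * (ht q)^-1)%g (uu p q * uu p q)%g.
Proof.
move=> p1 pq qs s3.
have Up : nearly_short (uu p q) by apply: U_uu; lra.
have Uq : nearly_short (uu q s) by apply: U_uu; lra.
have -> : (ht p * ht p * (ht q)^-1 * (ht q)^-1)%g =
    (uu p q * lconj (uu q s) (uu p q))%g.
  rewrite (lconj_uu _ (supp_uu_le pq)); last by elra.
  by rewrite lconjE uu_def !mulgA mulgVK.
by apply: eMl; [exact: eqm_refl|exact: eC].
Qed.

Lemma ht_cube p q s : 1 / 10 <= p -> p <= q -> q + 1 / 100 <= s -> s <= 3 / 10 ->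
  eqm (ht p * ht p * ht p * (ht q)^-1 * (ht q)^-1 * (ht q)^-1)%g
      (uu p q * uu p q * uu p q)%g.
Proof.
move=> p1 pq qs s3.
have Up : nearly_short (uu p q) by apply: U_uu; lra.
have Uq : nearly_short (uu q s) by apply: U_uu; lra.
have -> : (ht p * ht p * ht p * (ht q)^-1 * (ht q)^-1 * (ht q)^-1)%g =
    (uu p q * lconj (uu q s) (uu p q) *
     lconj (uu q s * uu q s) (uu p q))%g.
  rewrite (lconj_uu2 _ (supp_uu_le pq)); last by elra.
  rewrite (lconj_uu _ (supp_uu_le pq)); last by elra.
  by rewrite !lconjE uu_def invgM !mulgA !mulgVK.
apply: eMl; last by apply: eC => //; exact: UM.
by apply: eMl; [exact: eqm_refl|exact: eC].
Qed.

(* The transition zones of the two ways of doubling the displacement differ by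
   the localized factors aa. *)
Lemma aa_eqm p q s : 12 / 100 <= p -> p <= q -> q <= 24 / 100 ->
  q + 1 / 100 <= s -> s <= 3 / 10 ->
  eqm (aa p * (aa q)^-1)%g
    ((ht p * ht p * (ht q)^-1 * (ht q)^-1)^-1 * (t2 p * (t2 q)^-1))%g.
Proof.
move=> p1 pq q2 qs s3.
have Uq : nearly_short (uu q s) by apply: U_uu; lra.
have [Us _ _] : eqm (ht p * ht p * (ht q)^-1 * (ht q)^-1)%g (uu p q * uu p q)%g.
  by apply: (@ht_sqr _ _ s); lra.
have [Ut _ _] := t2_uu p1 pq q2.
set z := (_^-1 * _)%g.
(* [z] turns out to be the conjugate of [aa p * (aa q)^-1] by [ht q * ht q], and on that support
   [ht q] may again be replaced by [uu q s]. *)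
have Uz : nearly_short z by apply: UM => //; exact: UV.
have -> : (aa p * (aa q)^-1)%g = lconj (uu q s * uu q s)^-1%g z.
  have -> : z = lconj (ht q * ht q)%g (aa p * (aa q)^-1)%g.
    by rewrite /z lconjE !aa_def !invgM !invgK !mulgA !mulgK.
  rewrite -(@lconj_uu2 q s (q + 10 * eta)); first by rewrite -lconj_mul mulVg lconjE mul1g invg1 mulg1.
    apply: suppM; [|apply: suppV]; apply: supp_sub (@supp_aa _) => r /andP[? ?]; elra.
  by elra.
by apply: eC => //; apply/UV/UM.
Qed.

(* Moving one of the two zones by a fixed map shows that the localized factors
   do not matter. *)
Lemma aa_eqm1 : eqm (aa (19 / 100) * (aa (24 / 100))^-1)%g 1%g.
Proof.
have Uaa q : 12 / 100 <= q -> q <= 24 / 100 -> nearly_short (aa (12 / 100) * (aa q)^-1)%g.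
  by move=> q1 q2; case: (@aa_eqm (12 / 100) q (26 / 100)) => //; lra.
have -> : (aa (19 / 100) * (aa (24 / 100))^-1)%g =
    ((aa (12 / 100) * (aa (19 / 100))^-1)^-1 * (aa (12 / 100) * (aa (24 / 100))^-1))%g.
  by rewrite invgM invgK mulgA mulgVK.
have U19 : nearly_short (aa (12 / 100) * (aa (19 / 100))^-1)%g by apply: Uaa; lra.
have U24 : nearly_short (aa (12 / 100) * (aa (24 / 100))^-1)%g by apply: Uaa; lra.
apply/(eqmod_divP UM UV EA1 EAM EAV EAU UR U19 U24).
(* [g] is the identity up to 13/100, hence on the zone at 12/100, and translates the zone at 19/100
   to the one at 24/100. *)
apply: eS; pose g := shift_bump (18 / 100) (5 / 100) (20 / 100).
have -> : (aa (12 / 100) * (aa (24 / 100))^-1)%g =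
    lconj g (aa (12 / 100) * (aa (19 / 100))^-1)%g.
  rewrite lconjM lconjV; congr (_ * _^-1)%g.
    rewrite (@lconj_eq_on _ _ g 1%g _ _ (@supp_aa _)).
      by rewrite lconjE mul1g invg1 mulg1.
    by move=> K r /andP[? ?]; rewrite shift_bump_le //; elra.
  rewrite (@lconj_eq_on _ _ g (Tr (5 / 100)) _ _ (@supp_aa _)).
    by rewrite lconj_Tr_aa; congr aa; lra.
  by move=> K r /andP[? ?]; rewrite shift_bump_mid //; elra.
apply: eC => //.
by apply/EAU/EA_shift_bump; elra.
Qed.

(** Let [u] be a bump of length 1/40. The bump from 19/100 to 24/100 is congruent to [u * u] by
    additivity, so doubling its displacement by squaring gives the fourth power of [u], whereas
    doubling by dilation gives [u]. Hence the cube of [u] is trivial, and so is its sixth power,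
    which is the class of the element in question. *)
Lemma EA_hc : short_inA (hc (19 / 100) * (hc (24 / 100))^-1)%g.
Proof.
have -> : (hc (19 / 100) * (hc (24 / 100))^-1 = ht (19 / 100) * ht (19 / 100) *
    ht (19 / 100) * (ht (24 / 100))^-1 * (ht (24 / 100))^-1 * (ht (24 / 100))^-1)%g.
  by rewrite !hc_def !invgM !mulgA.
apply: (@eqmod1 _ nearly_short).
(* The ends are the images of 19/100 and 24/100 under halving towards 1/10. *)
set u := uu (29 / 200) (17 / 100).
have Uu : nearly_short u by apply: U_uu; lra.
have uE : eqm (uu (19 / 100) (24 / 100)) (u * u)%g.
  have sh p q p' q' t : p' = p + t -> q' = q + t -> 1 / 10 <= p -> p <= q ->
      0 <= t -> q + t <= 3 / 10 -> t + 4 / 100 <= p ->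
      (3 * q - p) / 2 + 2 * t + 3 / 100 <= 40 / 100 -> eqm (uu p' q') (uu p q).
    by move=> -> ->; exact: uu_shift.
  rewrite -(@uu_chain _ (43 / 200)); apply: eMl.
    by apply: (sh _ _ _ _ (9 / 200)); lra.
  by apply: (sh _ _ _ _ (7 / 100)); lra.
have uE4 : eqm (u * (u * (u * u)))%g u.
  have E1 := @ht_sqr (19 / 100) (24 / 100) (26 / 100).
  have E2 : eqm (t2 (19 / 100) * (t2 (24 / 100))^-1)%g u.
    have t2E p q p' q' : p' = (p + 10^-1) / 2 -> q' = (q + 10^-1) / 2 ->
        12 / 100 <= p -> p <= q -> q <= 24 / 100 ->
        eqm (t2 p * (t2 q)^-1)%g (uu p' q').
      by move=> -> ->; exact: t2_uu.
    by apply: t2E; lra.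
  have {}E1 : eqm (ht (19 / 100) * ht (19 / 100) * (ht (24 / 100))^-1 *
     (ht (24 / 100))^-1)%g (u * (u * (u * u)))%g.
    rewrite (mulgA u u); apply: eT (eMl uE uE); apply: E1; lra.
  apply: (eT (eT (eS E1) _) E2).
  have [Us _ _] := E1; have [Ut _ _] := E2.
  apply/(eqmod_divP UM UV EA1 EAM EAV EAU UR Us Ut).
  by apply: eT (eS (@aa_eqm _ _ (26 / 100) _ _ _ _ _)) aa_eqm1; lra.
have u3 := eqmod_cancel UM UV EA1 EAM EAU UR Uu uE4.
have E3 := @ht_cube (19 / 100) (24 / 100) (26 / 100).
apply: eT (E3 _ _ _ _) _; [lra..|].
apply: eT (eMl (eMl uE uE) uE) _.
rewrite (_ : (_ * _ * _ * _)%g = (u * (u * u) * (u * (u * u)))%g) ?mulgA//.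
by have := eMl u3 u3; rewrite mulg1 !mulgA.
Qed.

End Core.

(** * From bumps to a short cube of the rotation *)

Variable H : set (homeo (circle R)).
Hypotheses (H1 : H 1%g) (HM : forall f g, H f -> H g -> H (f * g)%g)
  (HV : forall f, H f -> H f^-1%g).
Hypothesis H_rot : forall s, H (rotation R s).
Hypothesis H_bump : forall p c, 1 / 100 <= p -> p + 2 * eta <= c ->
  (3 * c - p) / 2 + 2 * eta <= 99 / 100 -> exists g X,
    [/\ H g, periodic X, (forall K, is_lift g (X K)) &
      forall K r, 0 <= r < 1 -> X K r = bump p c K r].

Variables (gam : R) (d : nat -> R).
Hypotheses (betaS : forall K, beta K.+1 = 2 * beta K + d K)
  (d_cases : forall K, [\/ d K = 0, d K = gam | d K = - gam]).

Lemma periodic_Tr s : periodic (Tr s).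
Proof. by move=> K r; rewrite !TrE addrAC. Qed.

Lemma short_Tr s : short H (Tr s).
Proof.
apply: (short_const (H_rot s)) => [|K]; first exact: periodic_Tr.
exact: rot_fun_lift.
Qed.

Lemma line_short_bump p c : 1 / 100 <= p -> p + 2 * eta <= c ->
  (3 * c - p) / 2 + 2 * eta <= 99 / 100 -> line_short H (bump p c).
Proof.
move=> p1 pc c99; split.
  have := @supp_bump p c _ _ pc p1 c99; apply: supp_sub => r /andP[? ?].
  by rewrite /in01; apply/andP; split; lra.
have [g [X [Hg pX gX XE]]] := H_bump p1 pc c99.
by exists X => //; exact: (short_const Hg).
Qed.

(* A short element equal to the rotation by beta on a fixed interval: if w is
   one for beta and D is a contraction by 1/2, then D^-1 w D is one for
   2 * beta. *)
Lemma local_rotation : exists2 w, short H w &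
  forall K r, 2 / 100 <= r -> r <= 65 / 100 -> w K r = r + beta K.
Proof.
have [|||gB [XB [HgB pXB gXB XBE]]] := @H_bump (1 / 100) (66 / 100); [elra..|].
(* The inverse bump contracts towards 1/100. The translation by 16/100 moves the fixed point to
   33/100, so that [[2/100, 65/100]] is mapped well inside itself, with room for the angles. *)
pose D : sbij R := (Tr (16 / 100) * XB^-1)%g.
pose gD := (rotation R (16 / 100) * gB^-1)%g.
have gDD K : is_lift gD (D K).
  by apply: is_liftM; [exact: rot_fun_lift|exact: is_liftV].
have DE K r : 3 / 200 <= r -> r <= 66 / 100 -> D K r = (r + 1 / 100) / 2 + 16 / 100.
  move=> r1 r2; rewrite /D sbijM TrE; congr (_ + _); apply: sbijV_eq.
  rewrite XBE; last by apply/andP; split; lra.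
  by rewrite bump_dbl; elra.
pose W := fix W n : sbij R :=
  if n is m.+1 then (Tr (d m) * D^-1 * W m * D)%g else Tr (beta 0).
have WS n K r : W n.+1 K r = D^-1%g K (W n K (D K r)) + d n by [].
have pD : periodic D by apply: periodicM; [exact: periodic_Tr|exact: periodicV].
have pW n : periodic (W n).
  elim: n => [|n IH]; first exact: periodic_Tr.
  do 3?[apply: periodicM => //]; [exact: periodic_Tr|exact: periodicV].
pose S := [set rotation R gam; rotation R (beta 0); gD].
have gW n : exists m g, [/\ (m <= 3 * n + 1)%N, word S m g &
    forall K, is_lift g (W n K)].
  elim: n => [|n [m [g [mn Wg gW]]]].
    exists 1%N, (rotation R (beta 0)); split=> //.
      by apply: word_gen; left; right.
    by move=> K; exact: rot_fun_lift.
  have [k [t [k1 Wt tL]]] : exists k t, [/\ (k <= 1)%N, word S k t &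
      forall K, is_lift t (Tr (d n) K)].
    have Sg : S (rotation R gam) by left; left.
    have [->|->|->] := d_cases n.
    - exists 0%N, 1%g; split=> //; first exact: word0.
      by move=> K r /=; rewrite addr0.
    - exists 1%N, (rotation R gam); split=> //; first exact: word_gen.
      by move=> K; exact: rot_fun_lift.
    - exists 1%N, (rotation R gam)^-1%g; split=> //.
        by apply: wordV; exact: word_gen.
      by move=> K; exact: rot_fun_lift.
  have WD : word S 1 gD by apply: word_gen; right.
  exists (k + 1 + m + 1)%N, (t * gD^-1 * g * gD)%g; split.
  - by rewrite mulnS; move: mn k1; lia.
  - by do 3?[apply: wordM => //]; exact: wordV.
  - by move=> K; do 3?[apply: is_liftM => //]; exact: is_liftV.
have WE n : forall K r, 2 / 100 <= r -> r <= 65 / 100 -> W n K r = r + beta n.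
  elim: n => [//|n IH] K r r1 r2; bound n.
  rewrite WS DE; [|lra..].
  rewrite IH; [|lra..].
  rewrite (@sbijV_eq _ D K (r + 2 * beta n)); last by rewrite DE; elra.
  by rewrite betaS addrA.
(* The diagonal sequence: index [K] receives the [K]-th word, of length at most [3 * K + 1]. *)
exists (@SBij R (fun K => W K K) (fun K => sbij_inv (W K) K)
  (fun K => @sbij_funK _ (W K) K) (fun K => @sbij_invK _ (W K) K)).
  split; first by move=> K r; exact: pW.
  exists S; split.
  - by rewrite !finite_setU; repeat split; exact: finite_set1.
  - by move=> _ [[->|->]|->]; rewrite ?/gD; [exact: H_rot|exact: H_rot|];
      apply: HM; [exact: H_rot|exact: HV].
  - exists 3%N => K; have [m [g [mn Wg gWK]]] := gW K.
    by exists m, g; split=> //; [lia|exact: gWK].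
by move=> K r r1 r2; exact: WE.
Qed.

(** The short [w] of [local_rotation] replaces [turn]: both agree around the bump, and elsewhere the
    bump is the identity, so the unknown values of [w] cancel. *)
Lemma line_short_conj_turn p : 1 / 10 <= p -> p <= 3 / 10 ->
  line_short H (lconj turn (bump p (43 / 100))).
Proof.
move=> p1 p3.
have sB : supp (fun r => 10 / 100 <= r <= 60 / 100) (bump p (43 / 100)).
  by apply: supp_bump; elra.
have sTB : supp (fun r => 9 / 100 <= r <= 61 / 100) (lconj turn (bump p (43 / 100))).
  apply: (supp_lconj sB) => K r /andP[? ?]; bound K.
  by rewrite turnE; apply/andP; split; elra.
split.
  apply: supp_sub sTB => r /andP[? ?]; rewrite /in01; apply/andP; split; lra.
have [|||g [X [Hg pX gX XE]]] := @H_bump p (43 / 100); [elra..|].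
have EX : short H X by exact: (short_const Hg).
have [w Ew wE] := local_rotation.
exists (lconj w X).
  by rewrite lconjE; apply: shortM; [exact: shortM|exact: shortV].
move=> K r /andP[r0 r1]; bound K; rewrite !lconjE !sbijM.
have [/andP[r8 r62]|nr] := boolP (8 / 100 <= r <= 62 / 100).
  rewrite (@sbijV_eq _ w K (r - beta K)); last by rewrite wE; elra.
  rewrite turnVE XE; last by apply/andP; split; elra.
  have sB' : supp (fun r => 7 / 100 <= r <= 63 / 100) (bump p (43 / 100)).
    by apply: supp_bump; elra.
  have /andP[? ?] : 7 / 100 <= bump p (43 / 100) K (r - beta K) <= 63 / 100.
    by apply: (supp_stable K sB'); apply/andP; split; elra.
  by rewrite wE ?turnE //; lra.
transitivity r; last first.
  rewrite -!sbijM -lconjE sTB // => /andP[? ?]; move/negP: nr; apply.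
  by apply/andP; split; lra.
(* Otherwise [w^-1 r] lies in some translate by [m] of the support of the bump. There [w] is the
   rotation by [beta K], so [r - m] is in [(0, 1)]; this forces [m = 0] and contradicts the position
   of [r]. *)
suff E : X K (w^-1%g K r) = w^-1%g K r by rewrite E sbijVK.
set s := w^-1%g K r; have wsr : w K s = r by exact: sbijVK.
have [pw _] := Ew.
have [m /andP[sm ms]] : exists m : int, m%:~R <= s < m%:~R + 1.
  by exists (Num.floor s); rewrite floor_le //= -[X in _ + X]/(1%:~R) -intrD floorD1_gt.
rewrite -[s](subrK m%:~R) periodic_int//; congr (_ + _).
rewrite XE; last by apply/andP; split; lra.
apply: sB => /andP[s1 s6].
have ws : w K (s - m%:~R) = r - m%:~R.
  by apply: (addIr m%:~R); rewrite -periodic_int // !subrK.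
move: ws; rewrite wE; [|lra..] => ws.
have m0 : m = 0 by apply: small_int; elra.
move: ws; rewrite m0 !subr0 => ws; rewrite m0 in s1 s6.
move/negP: nr; apply; apply/andP; split; elra.
Qed.

Lemma hc_le p K r : r <= p - eta -> hc p K r = r.
Proof. by move=> rp; rewrite hc_def !sbijM !ht_le. Qed.

Lemma hc_ge p K r : p + 6 * eta <= r -> hc p K r = r - 3 * beta K.
Proof.
bound K => rp; rewrite hc_def !sbijM (@ht_ge p K r); last by elra.
rewrite (@ht_ge p K (r - beta K)); last by elra.
by rewrite ht_ge; elra.
Qed.

Lemma hcV_le p K r : r <= p - eta -> (hc p)^-1%g K r = r.
Proof. by move=> rp; apply: sbijV_eq; rewrite hc_le. Qed.

Lemma hcV_ge p K r : p + 9 * eta <= r -> (hc p)^-1%g K r = r + 3 * beta K.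
Proof. by bound K => rp; apply: sbijV_eq; rewrite hc_ge; elra. Qed.

Lemma hc_disp p K r : r - 18 * eta <= hc p K r <= r + 18 * eta.
Proof.
have D : disp (6 * eta + 6 * eta + 6 * eta) (hc p).
  by rewrite hc_def; do 2?[apply: dispM]; exact: disp_ht.
by have /andP[? ?] := disp_bound K r D; apply/andP; split; elra.
Qed.

Lemma hcV_disp p K r : r - 18 * eta <= (hc p)^-1%g K r <= r + 18 * eta.
Proof.
have /andP[] := hc_disp p K ((hc p)^-1%g K r); rewrite sbijVK => ? ?.
by apply/andP; split; lra.
Qed.

Lemma lconj_Tr_hc s p : lconj (Tr s) (hc p) = hc (p + s).
Proof. by rewrite !hc_def !lconjM !lconj_Tr_ht. Qed.

Lemma supp_hc p q : p <= q ->
  supp (fun r => p - eta <= r <= q + 9 * eta) (hc p * (hc q)^-1)%g.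
Proof.
move=> pq K r /negP; bound K; rewrite negb_and -!ltNge !sbijM => /orP[rp|rp].
  by rewrite hcV_le ?hc_le; elra.
by rewrite hcV_ge ?hc_ge; elra.
Qed.

Lemma line_short_shift s x a b : 0 <= a -> a <= b -> b < 1 -> 0 <= a + s ->
  b + s < 1 -> supp (fun r => a <= r <= b) x -> line_short H x ->
  line_short H (lconj (Tr s) x).
Proof.
move=> a0 ab b1 as0 bs1 sx [_ [X EX Xx]]; split.
  apply: (supp_lconj sx) => K r /andP[? ?].
  by rewrite /in01 TrE; apply/andP; split; lra.
exists (lconj (Tr s) X).
  by rewrite lconjE; apply: shortM; [apply: shortM|apply: shortV] => //; exact: short_Tr.
move=> K r /andP[r0 r1]; rewrite !lconjE !sbijM TrV; congr (_ + _).
have [pX _] := EX.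
by apply: (periodic_ext _ a0 ab b1 sx pX Xx); rewrite TrE; lra.
Qed.

Lemma line_short_hc1 : line_short H (hc (19 / 100) * (hc (24 / 100))^-1)%g.
Proof.
by have [_] := EA_hc (line_short1 H1) (@line_shortM _ H) (@line_shortV _ H)
  line_short_bump line_short_conj_turn.
Qed.

(** Translated copies of the basic bump of length 1/20 telescope. The bound on [n] keeps all of them
    within one period. *)
Lemma line_short_hc n : (n <= 10)%N ->
  line_short H (hc (19 / 100) * (hc (19 / 100 + n%:R / 20))^-1)%g.
Proof.
elim: n => [_|n IH n10].
  by rewrite mul0r addr0 mulgV; exact: line_short1.
have -> : (hc (19 / 100) * (hc (19 / 100 + n.+1%:R / 20))^-1)%g =
    (hc (19 / 100) * (hc (19 / 100 + n%:R / 20))^-1 *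
     lconj (Tr (n%:R / 20)) (hc (19 / 100) * (hc (24 / 100))^-1))%g.
  rewrite lconjM lconjV !lconj_Tr_hc mulgA mulgVK.
  by congr (_ * (hc _)^-1)%g; rewrite -natr1; lra.
apply: line_shortM; first by apply: IH; exact: ltnW.
have n9 : n%:R <= 9 :> R by rewrite ler_nat -ltnS.
have n0 : 0 <= n%:R :> R by rewrite ler0n.
apply: (@line_short_shift _ _ (18 / 100) (25 / 100)); [lra..| |exact: line_short_hc1].
have q24 : 19 / 100 <= 24 / 100 :> R by lra.
by apply: supp_sub (supp_hc q24) => r /andP[? ?]; apply/andP; split; elra.
Qed.

(* Two translation bumps of length 1/2, one of them conjugated by the short
   bump x in order to match the transition zones, make up a rotation. *)
Lemma short_turn3V : short H (turn^-1 * turn^-1 * turn^-1)%g.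
Proof.
pose q : R := 19 / 100; pose q1 : R := q + 1 / 20; pose q2 : R := q + 1 / 2.
have [_ [X EX XE]] := @line_short_hc 1 isT.
have [_ [Y EY YE]] := @line_short_hc 10 isT.
rewrite -[19 / 100]/q -/q1 in XE.
rewrite -[19 / 100]/q (_ : 10%:R / 20 = 1 / 2) -/q2 in YE; last by lra.
have [pX _] := EX; have [pY _] := EY.
pose x := (hc q * (hc q1)^-1)%g; pose y := (hc q * (hc q2)^-1)%g.
have sx : supp (fun r => 18 / 100 <= r <= 25 / 100) x.
  have q24 : q <= q1 by rewrite /q1; lra.
  apply: supp_sub (supp_hc q24) => r; rewrite /q1 /q => /andP[? ?].
  by apply/andP; split; elra.
have sy : supp (fun r => 18 / 100 <= r <= 70 / 100) y.
  have q24 : q <= q2 by rewrite /q2; lra.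
  apply: supp_sub (supp_hc q24) => r; rewrite /q2 /q => /andP[? ?].
  by apply/andP; split; elra.
have {}XE K r : - (7 / 10) < r -> r < 11 / 10 -> X K r = x K r.
  by move=> *; apply: (periodic_ext _ _ _ _ sx pX XE); lra.
have {}YE K r : - (29 / 100) < r -> r < 11 / 10 -> Y K r = y K r.
  by move=> *; apply: (periodic_ext _ _ _ _ sy pY YE); lra.
have -> : (turn^-1 * turn^-1 * turn^-1 = Y * X^-1 * lconj (Tr (1 / 2)) Y * X)%g; last first.
  apply: shortM => //; apply: shortM; first by apply: shortM => //; exact: shortV.
  by rewrite lconjE; apply: shortM; [apply: shortM|apply: shortV] => //; exact: short_Tr.
(* The two conjugators differ by the unit translation, which commutes with the periodic [Y]. Each
   form is convenient on one side of the window. *)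
have cY : lconj (Tr (- (1 / 2))) Y = lconj (Tr (1 / 2)) Y.
  apply: sbij_eqP => K r; rewrite !lconjE !TrV !sbijM !TrE.
  by rewrite opprK (_ : r + 1 / 2 = r - 1 / 2 + 1) ?pY; lra.
set Z := (Y * _ * _ * _)%g.
have pZ : periodic Z.
  rewrite /Z lconjE; repeat first [exact: pX | exact: pY | exact: periodic_Tr |
    apply: periodicM | apply: periodicV].
suff ZE K r : - (6 / 100) <= r -> r <= 94 / 100 -> Z K r = r - 3 * beta K.
  apply: sbij_eqP => K r; transitivity (r - beta K - beta K - beta K) => //.
  pose m := Num.floor (r + 6 / 100).
  have rm : r = r - m%:~R + m%:~R by rewrite subrK.
  have m1 : m%:~R <= r + 6 / 100 by exact: floor_le.
  have m2 : r + 6 / 100 < m%:~R + 1 by rewrite -[1]/(1%:~R) -intrD floorD1_gt.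
  by rewrite [in RHS]rm periodic_int // ZE; lra.
move=> r1 r2; bound K.
have Zr : Z K r = Y K (X^-1%g K (lconj (Tr (1 / 2)) Y K (X K r))) by [].
have xM s : x K s = hc q K ((hc q1)^-1%g K s) by [].
have yM s : y K s = hc q K ((hc q2)^-1%g K s) by [].
have cYl s : - (7 / 10) < s -> s < 6 / 10 ->
    lconj (Tr (1 / 2)) Y K s = hc (q - 1 / 2) K ((hc q)^-1%g K s).
  move=> s1 s2; rewrite -cY -[RHS]/((hc (q - 1 / 2) * (hc q)^-1)%g K s).
  have -> : (hc (q - 1 / 2) * (hc q)^-1)%g = lconj (Tr (- (1 / 2))) y.
    by rewrite /y lconjM lconjV !lconj_Tr_hc; congr (_ * (hc _)^-1)%g; rewrite /q2; lra.
  rewrite !lconjE !TrV !sbijM YE //; rewrite TrE; lra.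
have cYr s : 3 / 10 < s -> s < 11 / 10 ->
    lconj (Tr (1 / 2)) Y K s = hc q2 K s.
  move=> s1 s2; rewrite -[RHS](_ : (hc q2 * (hc (q2 + 1 / 2))^-1)%g K s = _).
    have -> : (hc q2 * (hc (q2 + 1 / 2))^-1)%g = lconj (Tr (1 / 2)) y.
      by rewrite /y lconjM lconjV !lconj_Tr_hc.
    rewrite !lconjE !TrV !sbijM YE //; rewrite TrE; lra.
  by rewrite sbijM hcV_le // /q2 /q; elra.
rewrite Zr {Zr pZ}; clear Z cY pX pY EX EY sx sy.
(* This cut separates the transition zones at [q] and [q1] from those at [q2]. *)
have [r44|r44] := leP r (44 / 100).
  have /andP[b1 b2] := hcV_disp q1 K r.
  set s := (hc q1)^-1%g K r in b1 b2.
  have /andP[b3 b4] := hc_disp q K s.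
  have /andP[b5 b6] := hcV_disp q K (s - 3 * beta K).
  have /andP[b7 b8] := hc_disp q1 K ((hc q)^-1%g K (s - 3 * beta K)).
  have srE : hc q1 K s = r by exact: sbijVK.
  rewrite XE; [|lra..]; rewrite xM -/s.
  rewrite cYl; [|elra..]; rewrite sbijK.
  rewrite (@hc_ge (q - 1 / 2)); last by rewrite /q; elra.
  set t := hc q1 K ((hc q)^-1%g K (s - 3 * beta K)) in b7 b8.
  rewrite (@sbijV_eq _ X K t); last first.
    by rewrite XE; [rewrite xM /t sbijK sbijVK|elra..].
  rewrite YE; [|elra..].
  rewrite yM hcV_le; last by rewrite /q2 /q; elra.
  (* 43/200 is the midpoint of [q] and [q1]: to its left [hc q1] is still the identity, to its right
     [hc q] is already a translation. Conjugation by [X] has thus separated two zones that would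
     overlap at [q]. *)
  have [s21|s21] := leP s (43 / 200).
    have sE : hc q1 K s = s by rewrite hc_le // /q1 /q; elra.
    have tE : t = (hc q)^-1%g K (s - 3 * beta K).
      by rewrite /t hc_le // /q1 /q; elra.
    by rewrite tE sbijVK -srE sE.
  have tE : t = r.
    by rewrite /t hcV_ge ?subrK // /q; elra.
  by rewrite tE hc_ge // /q; elra.
(* At [q2] the end of one bump follows directly upon the start of the other, so [hc q2] and its
   inverse cancel without any correction. *)
have /andP[b1 b2] := hc_disp q2 K r.
have Xid s : 4 / 10 < s -> s < 1 -> X K s = s.
  move=> s1 s2; rewrite XE; [|lra..].
  rewrite xM hcV_ge; last by rewrite /q1 /q; elra.
  by rewrite hc_ge ?addrK // /q; elra.
rewrite Xid; [|lra..]; rewrite cYr; [|lra..].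
rewrite (@sbijV_eq _ X K (hc q2 K r)); last by rewrite Xid //; elra.
by rewrite YE; [rewrite yM sbijK hc_ge // /q; elra|elra..].
Qed.

End Line.

(** * Diophantine approximation and word distance *)

Section Angles.
Variable R : realType.

(** Pigeonhole: of [M.+2] fractional parts, two fall into the same of [M.+1] boxes of width less
    than [eps]. *)
Lemma dirichlet (x eps : R) : 0 < eps ->
  exists (q : nat) (p : int), (0 < q)%N /\ `|q%:R * x - p%:~R| < eps.
Proof.
move=> eps0; pose M := Num.truncn eps^-1.
have Me : eps^-1 < M.+1%:R by exact: truncnS_gt.
have M0 : 0 < M.+1%:R :> R by rewrite ltr0n.
pose y (i : nat) : R := i%:R * x - (Num.floor (i%:R * x))%:~R.
have y_itv i : 0 <= y i < 1.
  rewrite /y subr_ge0 ltrBlDr addrC.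
  by have /andP[-> /=] := floor_itv (i%:R * x); rewrite intrD.
pose t i := Num.truncn (M.+1%:R * y i).
have tP i : (t i)%:R <= M.+1%:R * y i < (t i).+1%:R.
  by apply: truncn_itv; have /andP[y0 _] := y_itv i; exact: mulr_ge0.
have tM i : (t i < M.+1)%N.
  have /andP[t1 _] := tP i; have /andP[_ y1] := y_itv i.
  rewrite -(ltr_nat R); apply: le_lt_trans t1 _.
  by rewrite -[ltRHS]mulr1 ltr_pM2l.
pose f (i : 'I_M.+2) : 'I_M.+1 := Ordinal (tM i).
have [i [j [ij tij]]] : exists i j : nat, (i < j)%N /\ t i = t j.
  apply: contrapT => no.
  have : injective f.
    move=> i j /(congr1 val) /= tij; apply: val_inj => /=.
    apply: contrapT => /eqP; rewrite neq_ltn => /orP[] ij; apply: no.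
      by exists i, j.
    by exists j, i.
  by move/leq_card; rewrite !card_ord ltnn.
exists (j - i)%N, (Num.floor (j%:R * x) - Num.floor (i%:R * x)).
split; first by rewrite subn_gt0.
have -> : (j - i)%:R * x - (Num.floor (j%:R * x) - Num.floor (i%:R * x))%:~R =
    y j - y i by rewrite /y natrB ?(ltnW ij)// intrB; ring.
apply: (@lt_trans _ _ M.+1%:R^-1); last first.
  by rewrite -[eps]invrK ltf_pV2 // posrE // invr_gt0.
rewrite -(ltr_pM2l M0) mulfV ?gt_eqF//.
rewrite -[X in X * _](gtr0_norm M0) -normrM mulrBr.
have := tP i; have := tP j; rewrite tij -!natr1 => /andP[? ?] /andP[? ?].
by rewrite ltr_norml; apply/andP; split; lra.
Qed.

Lemma dirichlet_large (x eps : R) (N : nat) : 0 < eps ->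
  exists (q : nat) (p : int), (N < q)%N /\ `|q%:R * x - p%:~R| < eps.
Proof.
move=> /(dirichlet (N.+1%:R * x)) [q [p [q0 qp]]].
exists (q * N.+1)%N, p; split; first by rewrite (leq_trans _ (leq_pmull _ q0)).
by rewrite natrM -mulrA.
Qed.

Lemma irrational_neq (x : R) (q : nat) (p : int) : irrational x -> (0 < q)%N ->
  q%:R * x - p%:~R != 0.
Proof.
move=> xirr q0; apply/eqP => /eqP; rewrite subr_eq0 => /eqP qx; apply: xirr.
apply/rationalP; exists p, q; rewrite -qx mulrC mulKf //.
by rewrite pnatr_eq0 -lt0n.
Qed.

(** Doubling an angle of [[- gam, gam]] and correcting by [gam], [- gam] or 0 leads back to this
    interval, where [gam] is itself the absolute value of a small multiple of [alpha] modulo 1. *)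
Lemma angles (alpha eta : R) : irrational alpha -> 0 < eta ->
  exists (beta d : nat -> R) (gam : R),
  [/\ forall K, - eta <= beta K <= eta,
      forall K, beta K.+1 = 2 * beta K + d K,
      forall K, [\/ d K = 0, d K = gam | d K = - gam] &
      forall K, exists (n : nat) (m : int), (2 ^ K <= n)%N /\
        beta K = n%:R * alpha - m%:~R].
Proof.
move=> irr eta0.
have [q [p [q0 qp]]] := dirichlet alpha eta0.
pose gam0 := q%:R * alpha - p%:~R; pose gam := `|gam0|.
have gam_gt0 : 0 < gam by rewrite normr_gt0; exact: irrational_neq.
have [n0 [m0 [qn0 nm0]]] := dirichlet_large alpha q gam_gt0.
pose dig b := if gam < 2 * b then - gam else if 2 * b < - gam then gam else 0.
pose beta := fix beta K : R :=
  if K is K'.+1 then 2 * beta K' + dig (beta K') else n0%:R * alpha - m0%:~R.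
have bg K : - gam <= beta K <= gam.
  elim: K => [|K /andP[IH1 IH2]].
    by rewrite -ler_norml ltW.
  rewrite /= /dig; case: ltP => [?|?]; first by apply/andP; split; lra.
  by case: ltP => ?; apply/andP; split; lra.
exists beta, (fun K => dig (beta K)), gam; split.
- move=> K; have /andP[b1 b2] := bg K; have g : gam <= eta by exact: ltW.
  by apply/andP; split; lra.
- by [].
- move=> K; rewrite /dig; case: ifP => _; first exact: Or33.
  by case: ifP => _; [exact: Or32|exact: Or31].
(* A correction changes [n] by at most [q], so the surplus [q] makes the bound inductive:
   [2 * (2 ^ K + q) - q = 2 ^ K.+1 + q]. The start needs [n0 > q]. *)
move=> K; suff [n [m [nK ->]]] : exists (n : nat) (m : int),
    (2 ^ K + q <= n)%N /\ beta K = n%:R * alpha - m%:~R.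
  by exists n, m; split=> //; apply: leq_trans nK; exact: leq_addr.
elim: K => [|K [n [m [nK IH]]]].
  by exists n0, m0; split=> //; rewrite expn0.
have [k [l [kK dE]]] : exists (k l : int), (- q%:Z <= k) /\
    dig (beta K) = k%:~R * alpha - l%:~R.
  have gamE : gam = gam0 \/ gam = - gam0 by rewrite /gam; case: (ger0P gam0) => _; [left|right].
  have [e [e1 dE]] : exists e : int, (- 1 <= e <= 1) /\ dig (beta K) = e%:~R * gam0.
    rewrite /dig; have [_|_] := ltP gam; last have [_|_] := ltP _ (- gam).
    - by case: gamE => ->; [exists (-1)|exists 1]; split=> //; rewrite ?mulN1r ?mul1r ?opprK.
    - by case: gamE => ->; [exists 1|exists (-1)]; split=> //; rewrite ?mulN1r ?mul1r.
    - by exists 0; split=> //; rewrite mul0r.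
  exists (e * q%:Z), (e * p); split; first by nia.
  by rewrite dE /gam0 !intrM; ring.
exists `|(2 * n%:Z + k)%R|%N, (2 * m + l); split.
  by rewrite expnS; lia.
have <- : (2 * n%:Z + k)%:~R = `|(2 * n%:Z + k)%R|%N%:R :> R.
  by rewrite -[RHS]/(Posz _)%:~R; congr (_%:~R); lia.
rewrite [LHS]/= dE IH !intrD !intrM.
change (n%:Z%:~R : R) with (n%:R : R); rewrite (_ : 2%:~R = 2 :> R) //; ring.
Qed.

End Angles.

(** * Word distance and a criterion for distortion *)

Section WordDistance.
Variables (R : realType) (G : groupType).
Implicit Types (S H : set G) (f g : G).

(** [word_dist] from [g] to 1 reads off a word for [g^-1], whence the passage to the inverse. *)
Lemma word_dist_le S k g : word S k g -> (word_dist R S g 1%g <= k%:R%:E)%E.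
Proof.
move=> /wordV/word_prod [f [e [Sf gE]]]; apply: ereal_inf_lbound.
by exists k => //; exists f, e; split=> //; rewrite -gE mulVg.
Qed.

Lemma word_dist_ge0 S f g : (0 <= word_dist R S f g)%E.
Proof. by apply: le_ereal_inf_tmp => _ [k _ <-]; rewrite lee_fin. Qed.

Lemma is_subgroupP H : H 1%g -> (forall f g, H f -> H g -> H (f * g)%g) ->
  (forall f, H f -> H f^-1%g) -> is_subgroup H.
Proof.
move=> H1 HM HV; split; first by rewrite inE.
by move=> f g; rewrite !inE => Hf Hg; exact: HM Hf (HV _ Hg).
Qed.

Lemma generated_subgroup S : is_subgroup (generated S).
Proof.
split.
  by rewrite inE => A [[A1 _] _]; move: A1; rewrite inE.
move=> f g; rewrite !inE => Sf Sg A [Asub SA].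
have [_ AM] := Asub; have := AM f g. rewrite !inE. apply.
  exact: (Sf A (conj Asub SA)).
exact: (Sg A (conj Asub SA)).
Qed.

(* By subadditivity it suffices to bound the word length of f^n along a
   sequence of exponents n. *)
Lemma distorted_crit H f S (C : nat) (N L : nat -> nat) : is_subgroup H ->
  finite_set S -> S `<=` H -> S f -> (forall K, word S (L K) (f ^+ N K)%g) ->
  (forall K, (L K <= C * K.+1)%N) -> (forall K, (2 ^ K <= N K)%N) ->
  distorted_in R H f.
Proof.
move=> subH finS SH Sf WN LC NK.
exists (generated S); split.
- exact: generated_subgroup.
- by move=> g; apply; split.
- by move=> A [_ SA]; exact: SA.
exists S; split=> //.
have Dle n : (word_dist R S (f ^+ n)%g 1%g <= n%:R%:E)%E.
  by apply: word_dist_le; exact: wordX.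
have Dfin n : (word_dist R S (f ^+ n)%g 1%g \is a fin_num).
  rewrite ge0_fin_numE ?word_dist_ge0 //.
  by apply: le_lt_trans (Dle n) _; rewrite ltry.
pose D n := fine (word_dist R S (f ^+ n)%g 1%g).
have DE n : word_dist R S (f ^+ n)%g 1%g = (D n)%:E by rewrite fineK.
have D0 n : 0 <= D n by rewrite -lee_fin -DE word_dist_ge0.
(* Euclidean division of [n] by [N K]: the quotient counts copies of the short word for [f ^+ N K],
   and the remainder is spelled with the letter [f]. *)
have DK n K : D n <= n%:R / (N K)%:R * (L K)%:R + (N K)%:R.
  have N0 : (0 < N K)%N by apply: leq_trans (NK K); rewrite expn_gt0.
  have : word S (n %/ N K * L K + n %% N K) (f ^+ n)%g.
    rewrite [X in (f ^+ X)%g](divn_eq n (N K)) expgnDr.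
    apply: wordM; last exact: wordX.
    rewrite [X in (f ^+ X)%g]mulnC expgnA; elim: (n %/ N K)%N => [|k IH].
      by rewrite expg0 mul0n; exact: word0.
    by rewrite expgS mulSn; exact: wordM.
  move/word_dist_le; rewrite DE lee_fin => /le_trans; apply.
  rewrite natrD natrM lerD //; last by rewrite ler_nat ltnW // ltn_pmod.
  rewrite ler_wpM2r // ler_pdivlMr ?ltr0n // -natrM ler_nat.
  exact: leq_trunc_div.
under eq_fun do rewrite DE -EFinM.
apply: (@cvg_EFin _ _ _ _ (fun n => (D n * n%:R^-1)%:E) 0).
  by near=> n.
apply/cvgrPdist_le => e e0; rewrite /comp /=.
have [j jC] : exists j : nat, 4 * C%:R / e <= j.+1%:R.
  by exists (Num.truncn (4 * C%:R / e)); rewrite ltW // truncnS_gt.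
pose K := (2 * j)%N.
(* With [K = 2 * j], [N K] is at least the square of [j.+1] while [L K] is at most [2 * C * j.+1],
   so the choice of [j] makes the ratio at most [e / 2]. *)
have N0 : 0 < (N K)%:R :> R.
  by rewrite ltr0n; apply: leq_trans (NK K); rewrite expn_gt0.
have LK : (L K)%:R / (N K)%:R <= e / 2.
  rewrite ler_pdivrMr //.
  have L1 : (L K)%:R <= C%:R * (2 * j.+1%:R) :> R.
    rewrite -!natrM ler_nat; apply: leq_trans (LC K) _.
    by rewrite leq_mul2l /K; apply/orP; right; lia.
  have N1 : j.+1%:R * j.+1%:R <= (N K)%:R :> R.
    rewrite -natrM ler_nat; apply: leq_trans (NK K).
    by rewrite /K mulnC expnM -mulnn leq_mul // ltn_expl.
  apply: le_trans L1 _; apply: (@le_trans _ _ (e / 2 * (j.+1%:R * j.+1%:R))).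
    rewrite ler_pdivrMr // in jC.
    have j0 : 0 <= j.+1%:R :> R by exact: ler0n.
    by nra.
  by rewrite ler_wpM2l // divr_ge0 // ltW.
near=> n.
have n0 : 0 < n%:R :> R by rewrite ltr0n; near: n; exists 1%N.
rewrite sub0r normrN ger0_norm; last by rewrite mulr_ge0.
rewrite ler_pdivrMr //; apply: le_trans (DK n K) _.
have -> : e * n%:R = n%:R * (e / 2) + e / 2 * n%:R by lra.
rewrite lerD //; first by rewrite mulrAC -mulrA ler_wpM2l.
rewrite -ler_pdivrMl ?divr_gt0 // mulrC; near: n.
exact: nbhs_infty_ger.
Unshelve. all: by end_near.
Qed.

End WordDistance.

Section RotationDistorted.
Variable R : realType.
Variable H : set (homeo (circle R)).
Hypotheses (H1 : H 1%g) (HM : forall f g, H f -> H g -> H (f * g)%g)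
  (HV : forall f, H f -> H f^-1%g) (H_rot : forall s, H (rotation R s)).

Lemma lift_eq (f g : homeo (circle R)) F G : is_lift f F -> is_lift g G ->
  (forall r, F r - G r \is a Num.int) -> f = g.
Proof.
move=> fF gG FG; apply: homeo_eqP => x; rewrite -[x]reprK.
by rewrite [LHS]fF [RHS]gG; exact/circle_piP.
Qed.

Lemma rotationX_lift (alpha : R) n :
  is_lift (rotation R alpha ^+ n)%g (fun r => r + n%:R * alpha).
Proof.
elim: n => [|n IH] r; first by rewrite mul0r addr0.
rewrite expgSr -natr1 mulrDl mul1r [in RHS](addrC (_ * _)) addrA -IH.
by rewrite -[RHS]/((rotation R alpha ^+ n)%g _) -rot_fun_lift.
Qed.

Lemma rotation_distorted (alpha eta : R) : irrational alpha -> 0 < eta ->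
  (forall (beta d : nat -> R) (gam : R), (forall K, - eta <= beta K <= eta) ->
    (forall K, beta K.+1 = 2 * beta K + d K) ->
    (forall K, [\/ d K = 0, d K = gam | d K = - gam]) ->
    exists2 X : sbij R, short H X &
      forall K r, X K r = r - beta K - beta K - beta K) ->
  distorted_in R H (rotation R alpha).
Proof.
move=> irr eta0 Hshort.
have [beta [d [gam [b_le bS dc bE]]]] := angles irr eta0.
have [X [_ [S [finS SH [C XC]]]] XE] := Hshort _ _ _ b_le bS dc.
have /choice[p pP] K : exists p : nat * nat, [/\ (p.1 <= C * K.+1)%N,
    (2 ^ K <= p.2)%N & word S p.1 (rotation R alpha ^+ p.2)%g].
  have [n [m [nK bK]]] := bE K; have [l [g [lC Wg gX]]] := XC K.
  exists (l, (n * 3)%N); split=> //=; first exact: leq_trans nK (leq_pmulr _ _).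
  (* [g] is the rotation by [- 3 * beta K], so its inverse is the power of exponent [n * 3] of the
     rotation by [alpha], up to the integer translation [3 * m] of lifts. *)
  rewrite (_ : (_ ^+ _)%g = g^-1%g); first exact: wordV.
  apply: (lift_eq (rotationX_lift _ _) (is_liftV gX)) => r.
  rewrite (@sbijV_eq _ X K (r + beta K + beta K + beta K)); last by rewrite XE !addrK.
  rewrite bK natrM (_ : _ - _ = (3 * m)%:~R) ?rpred_int // intrM.
  by rewrite (_ : 3%:~R = 3 :> R) //; ring.
pose S' := S `|` [set rotation R alpha].
apply: (@distorted_crit _ _ _ _ S' C (fun K => (p K).2) (fun K => (p K).1)).
- exact: is_subgroupP.
- by rewrite finite_setU; split=> //; exact: finite_set1.
- by move=> f [/SH|->].
- by right.
- move=> K; have [_ _] := pP K; apply: word_sub; exact: subsetUl.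
- by move=> K; have [] := pP K.
- by move=> K; have [] := pP K.
Qed.

End RotationDistorted.

(** * Homeomorphisms of the circle from lifts *)

Section GoodLifts.
Variable R : realType.
Implicit Types (F G : R -> R) (r s : R).

Lemma homeo_of_lift F G : cancel F G -> cancel G F -> continuous F ->
  continuous G -> (forall r, F (r + 1) = F r + 1) ->
  exists f : homeo (circle R), is_lift f F.
Proof.
move=> FK GK cF cG F1.
have G1 r : G (r + 1) = G r + 1 by rewrite -[r in LHS]GK -F1 FK.
pose c (A : R -> R) (x : circle R) : circle R := \pi_(circle R) (A (repr x)).
have cL (A : R -> R) : (forall r, A (r + 1) = A r + 1) -> is_lift (c A) A.
  move=> A1 x; apply/circle_piP.
  have /intrP[m mE] : repr (\pi_(circle R) x) - x \is a Num.int.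
    by apply/circle_piP; rewrite reprK.
  have -> : repr (\pi_(circle R) x) = x + m%:~R by rewrite -mE addrC subrK.
  by rewrite add1_int // addrAC subrr add0r rpred_int.
have cc (A : R -> R) : (forall r, A (r + 1) = A r + 1) -> continuous A -> continuous (c A).
  move=> A1 cA; apply/quotient_continuous.
  have -> : c A \o \pi_(circle R) = \pi_(circle R) \o A.
    by apply/funext => x; exact: cL.
  by move=> x; apply: continuous_comp; [exact: cA|exact: pi_continuous].
have cK (A B : R -> R) : (forall r, A (r + 1) = A r + 1) -> cancel B A ->
    cancel (c B) (c A).
  by move=> A1 BK x; rewrite {2}/c cL // BK reprK.
by exists (Homeo (cK G F G1 FK) (cK F G F1 GK) (cc F F1 cF) (cc G G1 cG)); exact: cL.
Qed.

Section Class.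
(** Instantiated with [locally_affine] and with [smooth]. Locality is what makes periodic extensions
    good. *)
Variable good : (R -> R) -> Prop.
Hypotheses (good_Tr : forall s, good (+%R^~ s))
  (good_comp : forall F G, good F -> good G -> good (F \o G))
  (good_continuous : forall F, good F -> continuous F)
  (good_local : forall F, (forall r, exists2 e, 0 < e & exists2 G, good G &
     forall s, `|s - r| < e -> F s = G s) -> good F).

Definition good_homeo : set (homeo (circle R)) := [set f | exists F G,
  [/\ cancel F G, cancel G F, {mono F : r s / r <= s}, good F /\ good G &
     is_lift f F]].

Lemma good_homeo1 : good_homeo 1%g.
Proof.
have g : good id.
  by apply: good_local => r; exists 1 => //; exists (+%R^~ 0) => // s _; rewrite addr0.
by exists id, id.
Qed.

Lemma good_homeoM f g : good_homeo f -> good_homeo g -> good_homeo (f * g)%g.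
Proof.
move=> [F [F' [FK F'K mF [gF gF'] fF]]] [G [G' [GK G'K mG [gG gG'] gGl]]].
exists (F \o G), (G' \o F'); split.
- exact: can_comp.
- exact: can_comp.
- by move=> r s /=; rewrite mF mG.
- by split; exact: good_comp.
- by move=> r; rewrite /= gGl fF.
Qed.

Lemma good_homeoV f : good_homeo f -> good_homeo f^-1%g.
Proof.
move=> [F [F' [FK F'K mF [gF gF'] fF]]]; exists F', F; split=> //.
  by move=> r s; rewrite -mF !F'K.
by move=> r; rewrite -[in LHS](F'K r) -fF /= homeo_funK.
Qed.

Lemma good_homeo_rot s : good_homeo (rotation R s).
Proof.
exists (+%R^~ s), (+%R^~ (- s)); split=> //.
- exact: addrK.
- exact: addrNK.
- by move=> r t; rewrite lerD2r.
- exact: rot_fun_lift.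
Qed.

Lemma periodize (a b : R) (x : sbij R) : 0 < a -> a <= b -> b < 1 ->
  (forall K K' r, x K r = x K' r) -> mono x ->
  supp (fun r => a <= r <= b) x -> good (x 0%N) -> good (x^-1%g 0%N) ->
  exists g X, [/\ good_homeo g, periodic X, (forall K, is_lift g (X K)) &
    forall K r, 0 <= r < 1 -> X K r = x K r].
Proof.
move=> a0 ab b1 xc mx sx gx gxV.
pose fl r : R := (Num.floor r)%:~R.
have fl1 r : fl (r + 1) = fl r + 1 by rewrite /fl floorDrz // floor1 intrD.
have fl_itv r : 0 <= r - fl r < 1.
  rewrite subr_ge0 ltrBlDl; have := floor_itv r; rewrite intrD; done.
have fl_eq r (m : int) : m%:~R <= r < m%:~R + 1 -> fl r = m%:~R.
  by move=> rm; congr (_%:~R); apply: floor_def; rewrite intrD.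
pose per (y : sbij R) r := y 0%N (r - fl r) + fl r.
have fl_per y r : supp (fun r => a <= r <= b) y -> fl (per y r) = fl r.
  move=> sy; apply: fl_eq; rewrite lerDr [X in _ < X]addrC ltrD2r.
  apply: (@supp_stable _ (fun r => 0 <= r < 1)) => //.
  by apply: supp_sub sy => s /andP[? ?]; apply/andP; split; lra.
have sxV := suppV sx.
have perK y : supp (fun r => a <= r <= b) y -> cancel (per y) (per y^-1%g).
  by move=> sy r; rewrite /per -/(per y r) fl_per // addrK sbijK subrK.
have per1 y r : per y (r + 1) = per y r + 1.
  by rewrite /per fl1 addrA; congr (y _ _ + _ + _); rewrite opprD addrACA subrr addr0.
have per_good y : supp (fun r => a <= r <= b) y -> good (y 0%N) -> good (per y).
  (* Within this radius, a point that crosses into a neighbouring period is outside the support for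
     both periods, so both formulas give the identity there. *)
  move=> sy gy; apply: good_local => r; exists (Num.min a (1 - b)).
    by rewrite lt_min; apply/andP; split; lra.
  exists ((+%R^~ (fl r)) \o (y 0%N \o (+%R^~ (- fl r)))).
    by apply: good_comp => //; apply: good_comp.
  move=> s; rewrite lt_min => /andP[]; rewrite !ltr_norml => /andP[s1 s2] /andP[s3 s4].
  rewrite /=; have /andP[r0 r1] := fl_itv r.
  have out t : t < a \/ b < t -> y 0%N t = t.
    by move=> tab; apply: sy => /andP[at_ tb]; case: tab; rewrite ltNge ?at_ ?tb.
  have [sr|sr] := ltP s (fl r).
    have flE : fl s = fl r - 1.
      have -> : fl r - 1 = (Num.floor r - 1)%:~R by rewrite intrD.
      by apply: fl_eq; rewrite intrD -/(fl r); apply/andP; split; lra.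
    by rewrite /per flE !out; [lra|left; lra|right; lra].
  have [rs|rs] := leP (fl r + 1) s.
    have flE : fl s = fl r + 1.
      have -> : fl r + 1 = (Num.floor r + 1)%:~R by rewrite intrD.
      by apply: fl_eq; rewrite intrD -/(fl r); apply/andP; split; lra.
    by rewrite /per flE !out; [lra|right; lra|left; lra].
  by rewrite /per (fl_eq s (Num.floor r)) //; apply/andP; split.
have perVK : cancel (per x^-1%g) (per x).
  by have := perK _ sxV; rewrite invgK.
have per_mono : {mono per x : r s / r <= s}.
  apply: le_mono => r s rs.
  have xin t : 0 <= x 0%N (t - fl t) < 1.
    apply: (@supp_stable _ (fun r => 0 <= r < 1)) => //.
    by apply: supp_sub sx => u /andP[? ?]; apply/andP; split; lra.
  have [E|E] := eqVneq (Num.floor r) (Num.floor s).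
    by rewrite /per /fl E ltrD2r (leW_mono (mx 0%N)) ltrD2r.
  have frs : fl r + 1 <= fl s.
    rewrite /fl -[X in _ + X]/(1%:~R) -intrD ler_int lezD1 lt_neqAle E.
    by apply: le_floor; exact: ltW.
  have /andP[? ?] := xin r; have /andP[? ?] := xin s.
  by rewrite /per; lra.
have cx := good_continuous (per_good x sx gx).
have cxV := good_continuous (per_good _ sxV gxV).
have [g gL] := homeo_of_lift (perK x sx) perVK cx cxV (per1 x).
exists g, (const_sbij (perK x sx) perVK); split.
- exists (per x), (per x^-1%g); split=> //; first exact: perK.
  by split; exact: per_good.
- by move=> K r; exact: per1.
- by move=> K; exact: gL.
- move=> K r r01; rewrite /= /per (fl_eq r 0) ?add0r // !subr0 addr0; exact: xc.
Qed.

End Class.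
End GoodLifts.

(** * Locally affine maps *)

Section LocallyAffine.
Variable R : realType.
Implicit Types (F G : R -> R) (r s : R).

Definition hinge (l r z : R) : R := if z <= 0 then l * z else r * z.

(** A local form of piecewise affinity, with one slope on each side of every point. It composes and
    glues easily; compactness of [[0, 1]] gives back a finite subdivision in [affine_partition]. *)
Definition locally_affine F := forall x, exists2 e, 0 < e &
  exists l r, forall y, `|y - x| < e -> F y = F x + hinge l r (y - x).

Lemma hinge_comp l r l' r' : exists l'' r'', forall z,
  hinge l' r' (hinge l r z) = hinge l'' r'' z.
Proof.
exists ((if 0 <= l then l' else r') * l), ((if 0 <= r then r' else l') * r) => z.
rewrite /hinge; have [z0|z0] := leP z 0.
  have [l0|l0] := leP 0 l; first by rewrite mulr_ge0_le0 // mulrA.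
  have [z1|z1] := eqVneq z 0; first by rewrite z1 !mulr0 if_same.
  by rewrite leNgt nmulr_rgt0 // lt_neqAle z1 z0 /= mulrA.
have [r1|r1] := leP 0 r; last by rewrite ltW ?mulrA // nmulr_rlt0.
have [r2|r2] := eqVneq r 0; first by rewrite r2 mul0r !mulr0 mul0r if_same.
have r3 : 0 < r by rewrite lt_neqAle eq_sym r2.
by rewrite leNgt pmulr_rgt0 // z0 /= mulrA.
Qed.

Lemma hinge_le l r z : `|hinge l r z| <= (`|l| + `|r|) * `|z|.
Proof.
rewrite /hinge; case: ifP => _; rewrite normrM ler_wpM2r //.
  by rewrite lerDl.
by rewrite lerDr.
Qed.

Lemma hingeK l r l' r' : 0 < l -> 0 < r -> l' * l = 1 -> r' * r = 1 ->
  cancel (hinge l r) (hinge l' r').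
Proof.
move=> l0 r0 ll rr x; rewrite {2}/hinge /hinge; have [x0|x0] := leP x 0.
  by rewrite pmulr_rle0 // x0 mulrA ll mul1r.
by rewrite leNgt pmulr_rgt0 // x0 /= mulrA rr mul1r.
Qed.

Lemma hinge_mono l r : 0 < l -> 0 < r -> {mono hinge l r : x y / x <= y}.
Proof.
move=> l0 r0; apply: le_mono => x y xy; rewrite /hinge.
have [x0|x0] := leP x 0; have [y0|y0] := leP y 0.
- by rewrite ltr_pM2l.
- by apply: (@le_lt_trans _ _ 0); rewrite ?pmulr_rle0 ?pmulr_rgt0.
- by have := lt_le_trans (lt_trans x0 xy) y0; rewrite ltxx.
- by rewrite ltr_pM2l.
Qed.

Lemma locally_affine_Tr s : locally_affine (+%R^~ s).
Proof.
move=> x; exists 1 => //; exists 1, 1 => y _.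
by rewrite /hinge if_same; lra.
Qed.

Lemma locally_affine_continuous F : locally_affine F -> continuous F.
Proof.
move=> FA x; have [e e0 [l [r lr]]] := FA x.
apply/cvgrPdist_le => d d0.
pose M := `|l| + `|r| + 1.
have M0 : 0 < M by rewrite /M ltr_wpDl // addr_ge0.
near=> y; have yx : `|y - x| < e.
  by near: y; rewrite /prop_near1; apply/nbhs_ballP; exists e => //= y; rewrite /ball /= distrC.
rewrite (lr y) // opprD addrA subrr add0r normrN.
apply: le_trans (hinge_le _ _ _) _.
have : `|y - x| < d / M.
  near: y; apply/nbhs_ballP; exists (d / M); first exact: divr_gt0.
  by move=> y; rewrite /ball /= distrC.
rewrite ltr_pdivlMr // => /ltW; apply: le_trans.
by rewrite mulrC ler_wpM2l // /M lerDl.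
Unshelve. all: by end_near.
Qed.

Lemma locally_affine_comp F G : locally_affine F -> locally_affine G ->
  locally_affine (F \o G).
Proof.
move=> FA GA x; have [e e0 [l [r lr]]] := GA x.
have [d d0 [l' [r' lr']]] := FA (G x).
have [l'' [r'' lr'']] := hinge_comp l r l' r'.
pose M := `|l| + `|r| + 1.
have M0 : 0 < M by rewrite /M ltr_wpDl // addr_ge0.
exists (Num.min e (d / M)); first by rewrite lt_min e0 divr_gt0.
exists l'', r'' => y; rewrite lt_min => /andP[ye yd].
have GE := lr _ ye; rewrite /= lr'; first by rewrite GE addrAC subrr add0r lr''.
rewrite GE addrAC subrr add0r; apply: le_lt_trans (hinge_le _ _ _) _.
rewrite ltr_pdivlMr // mulrC in yd; apply: le_lt_trans yd.
by rewrite ler_wpM2r // /M lerDl.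
Qed.

Lemma locally_affine_local F : (forall r, exists2 e, 0 < e &
    exists2 G, locally_affine G & forall s, `|s - r| < e -> F s = G s) ->
  locally_affine F.
Proof.
move=> FG x; have [e e0 [G GA GE]] := FG x; have [d d0 [l [r lr]]] := GA x.
exists (Num.min e d); first by rewrite lt_min e0.
exists l, r => y; rewrite lt_min => /andP[ye yd].
by rewrite GE // lr // GE // subrr normr0.
Qed.

Lemma locally_affine_hinge l r : locally_affine (hinge l r).
Proof.
move=> x; have [x0|x0] := eqVneq x 0.
  by exists 1 => //; exists l, r => y _; rewrite x0 subr0 {2}/hinge lexx mulr0 add0r.
exists `|x|; rewrite ?normr_gt0 //.
exists (if x <= 0 then l else r), (if x <= 0 then l else r) => y.
rewrite ltr_norml /hinge if_same => /andP[].
have [xn|xp] := leP x 0.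
  by rewrite ler0_norm // => ? ?; rewrite ifT; [ring|lra].
by rewrite gtr0_norm // => ? ?; rewrite ifF; [ring|apply/negbTE; rewrite -ltNge; lra].
Qed.

(** Let [u] be the supremum of the [t] for which [[0, t]] has such a subdivision. The left slope at
    [u] shows that [u] is attained, and the right slope would extend the subdivision if [u < 1]. *)
Lemma affine_partition F : locally_affine F ->
  exists s : seq R, itv_partition 0 1 s /\ forall i, (i < size s)%N -> exists l c : R,
    forall x, nth 0 (0 :: s) i <= x < nth 0 (0 :: s) i.+1 -> F x = l * x + c.
Proof.
move=> FA.
pose P t (s : seq R) := itv_partition 0 t s /\ forall i, (i < size s)%N -> exists l c : R,
    forall x, nth 0 (0 :: s) i <= x < nth 0 (0 :: s) i.+1 -> F x = l * x + c.
have step t t' (s : seq R) l c : P t s -> t < t' ->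
    (forall x, t <= x < t' -> F x = l * x + c) -> P t' (rcons s t').
  move=> [[sp /eqP sl] sF] tt' lc; split.
    by split; [rewrite rcons_path sp sl|rewrite last_rcons].
  move=> i; rewrite size_rcons ltnS leq_eqVlt => /orP[/eqP ->|is_].
    exists l, c => x; rewrite -rcons_cons !nth_rcons /= ltnS leqnn ltnn eqxx.
    by rewrite -[size s]/((size (0 :: s)).-1) nth_last /= sl; exact: lc.
  have [l' [c' lc']] := sF i is_; exists l', c' => x.
  rewrite -rcons_cons !nth_rcons /= !ltnS (ltnW is_) is_; exact: lc'.
pose A := [set t | 0 <= t <= 1 /\ exists s : seq R, P t s].
have A0 : A 0 by split; [rewrite lexx ler01|exists [::]; split].
have supA : has_sup A by split; [exists 0|exists 1 => t [/andP[]]].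
set u := sup A.
have u0 : 0 <= u by apply: ub_le_sup A0; case: supA.
have u1 : u <= 1 by apply: ge_sup; [exists 0|move=> t [/andP[]]].
have [e e0 [l [r lr]]] := FA u.
have [t [/andP[t0 t1] [s Ps]] tu] := sup_adherent e0 supA.
rewrite -/u in tu.
have t_u : t <= u.
  by apply: ub_le_sup; [case: supA|split; [rewrite t0|exists s]].
have [v Pv] : exists s : seq R, P u s.
  have [<-|tu'] := eqVneq t u; first by exists s.
  exists (rcons s u); apply: (step t u s l (F u - l * u) Ps).
    by rewrite lt_neqAle tu'.
  move=> x /andP[tx xu]; rewrite lr; last by rewrite ltr_norml; apply/andP; split; lra.
  by rewrite /hinge ifT; lra.
have [u_1|u_1] := eqVneq u 1; first by exists v; rewrite -u_1.
have {}u_1 : u < 1 by rewrite lt_neqAle u_1.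
pose u' := Num.min 1 (u + e / 2).
have uu' : u < u' by rewrite lt_min u_1 ltrDl divr_gt0.
have : u' <= u.
  apply: ub_le_sup; first by case: supA.
  split; first by rewrite ge_min lexx (le_trans u0 (ltW uu')).
  exists (rcons v u'); apply: (step u u' v r (F u - r * u) Pv uu').
  move=> x /andP[ux]; rewrite lt_min => /andP[_ xe].
  rewrite lr; last by rewrite ltr_norml; apply/andP; split; lra.
  rewrite /hinge; case: ifPn => [xu0|_]; last by lra.
  have -> : x = u by lra.
  by lra.
by rewrite leNgt uu'.
Qed.

Lemma PAff_lift (f : homeo (circle R)) F : is_lift f F ->
  {mono F : x y / x <= y} -> locally_affine F -> PAff_plus R f.
Proof.
move=> fF mF FA; split.
  exists F; split=> //; first exact: locally_affine_continuous.
  by move=> x y; rewrite (leW_mono mF).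
have [s [sp sF]] := affine_partition FA; exists 0, s; rewrite add0r; split=> //.
move=> i /sF[l [c lc]]; exists l, c => x /lc <-; exact: fF.
Qed.

End LocallyAffine.

(** * Smooth maps *)

Section Smooth.
Variable R : realType.
Implicit Types (F G : R -> R) (r s x y : R).

(** Derivatives are given by witnesses, so that closure properties follow by plain induction on
    [n]. *)
Fixpoint Cn n F : Prop := if n is m.+1 then
  exists2 F', (forall x, is_derive x 1 F (F' x)) & Cn m F' else True.

Definition smooth F := forall n, Cn n F.

Lemma CnW n F : Cn n.+1 F -> Cn n F.
Proof.
elim: n F => [//|n IH] F [F' dF CF']; exists F' => //; exact: IH.
Qed.

Lemma smooth_derive F : smooth F -> exists2 F',
  (forall x, is_derive x 1 F (F' x)) & smooth F'.
Proof.
move=> sF; have [F' dF _] := sF 1%N; exists F' => // n.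
have [G dG CG] := sF n.+1.
suff -> : F' = G by [].
by apply/funext => x; rewrite -(@derive_val _ _ _ _ _ _ _ (dF x)) -(@derive_val _ _ _ _ _ _ _ (dG x)).
Qed.

Lemma smooth_smooth_real F : smooth F -> smooth_real F.
Proof.
move=> sF n; elim: n F sF => [|n IH] F sF x.
  by have [F' dF _] := smooth_derive sF; rewrite derive1n0; exact: ex_derive.
have [F' dF sF'] := smooth_derive sF.
have E : F^`()%classic = F'.
  by apply/funext => y; rewrite derive1E derive_val.
by rewrite /derive1n iterSr E; exact: IH.
Qed.

Lemma smooth_continuous F : smooth F -> continuous F.
Proof.
move=> /smooth_derive[F' dF _] x.
by apply/differentiable_continuous/derivable1_diffP; exact: ex_derive.
Qed.

Lemma Cn_cst n (a : R) : Cn n (cst a).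
Proof.
elim: n a => [//|n IH] a; exists (cst 0) => // x; exact: is_derive_cst.
Qed.

Lemma Cn_id n : Cn n id.
Proof.
case: n => [//|n]; exists (cst 1); last exact: Cn_cst.
by move=> x; exact: is_derive_id.
Qed.

Lemma CnD n F G : Cn n F -> Cn n G -> Cn n (F + G).
Proof.
elim: n F G => [//|n IH] F G [F' dF CF'] [G' dG CG'].
by exists (F' + G'); [move=> x; exact: is_deriveD|exact: IH].
Qed.

Lemma smooth_Tr s : smooth (+%R^~ s).
Proof.
move=> n; have -> : +%R^~ s = id + cst s :> (R -> R) by apply/funext.
by apply: CnD; [exact: Cn_id|exact: Cn_cst].
Qed.

Lemma CnM n F G : Cn n F -> Cn n G -> Cn n (F * G).
Proof.
elim: n F G => [//|n IH] F G CF CG.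
have [F' dF CF'] := CF; have [G' dG CG'] := CG.
exists (F * G' + G * F'); first by move=> x; exact: is_deriveM.
by apply: CnD; apply: IH => //; exact: CnW.
Qed.

Lemma Cn_comp n F G : Cn n F -> Cn n G -> Cn n (F \o G).
Proof.
elim: n F G => [//|n IH] F G [F' dF CF'] CG.
have [G' dG CG'] := CG.
exists ((F' \o G) * G'); first by move=> x; exact: is_derive1_comp.
by apply: CnM => //; apply: IH => //; exact: CnW.
Qed.

Lemma CnV n F : (forall x, F x != 0) -> Cn n F -> Cn n (fun x => (F x)^-1).
Proof.
move=> F0; elim: n => [//|n IH] CF; have [F' dF CF'] := CF.
have CV := IH (CnW CF).
exists (cst (-1) * ((fun x => (F x)^-1) * (fun x => (F x)^-1)) * F').
  move=> x; have := is_deriveV (F0 x) (dF x).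
  suff -> : - F x ^- 2 *: F' x = (cst (-1) * ((fun x => (F x)^-1) * (fun x => (F x)^-1)) * F') x by [].
  by rewrite /GRing.scale /= mulN1r expr2 invfM.
by apply: CnM => //; apply: CnM; [exact: Cn_cst|exact: CnM].
Qed.

Lemma Cn_local n F : (forall r, exists2 e, 0 < e & exists2 G, Cn n G &
    forall s, `|s - r| < e -> F s = G s) -> Cn n F.
Proof.
elim: n F => [//|n IH] F FG.
have /choice[F' F'P] r : exists a, is_derive r 1 F a.
  have [e e0 [G [G' dG _] GE]] := FG r; exists (G' r).
  apply: near_eq_is_derive (dG r).
  apply/nbhs_ballP; exists e => //= s; rewrite /ball /= distrC => /GE ->.
  by [].
exists F' => //; apply: IH => r.
have [e e0 [G [G' dG CG'] GE]] := FG r; exists e => //; exists G' => // s sr.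
have dF : is_derive s 1 F (G' s).
  apply: near_eq_is_derive (dG s).
  apply/nbhs_ballP; exists (e - `|s - r|); first by rewrite /= subr_gt0.
  move=> t; rewrite /ball /= distrC => ts; rewrite GE //.
  rewrite -(subrKA s); apply: le_lt_trans (ler_normD _ _) _; lra.
by rewrite -(@derive_val _ _ _ _ _ _ _ dF) (@derive_val _ _ _ _ _ _ _ (F'P s)).
Qed.

(** Bootstrapping: the derivative of [G] is the inverse of [F' \o G], which is as regular as [G] is
    already known to be. *)
Lemma smooth_inverse F G F' : cancel F G -> cancel G F ->
  smooth F -> (forall x, is_derive x 1 F (F' x)) -> (forall x, F' x != 0) ->
  smooth G.
Proof.
move=> FK GK sF dF F0.
have sF' : smooth F'.
  have [F1 dF1 sF1] := smooth_derive sF; suff -> : F' = F1 by [].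
  by apply/funext => x; rewrite -(@derive_val _ _ _ _ _ _ _ (dF x)) derive_val.
elim=> [//|n IH]; exists (fun y => (F' (G y))^-1).
  move=> y; rewrite -[y in is_derive y]GK; apply: is_derive_inverse => //.
  - by near=> z; exact: FK.
  - by near=> z; exact: smooth_continuous.
by apply: (@CnV _ (F' \o G)) => [x|]; [exact: F0|exact: Cn_comp].
Unshelve. all: by end_near.
Qed.

End Smooth.

(** * A smooth homeomorphism with slope 1, then 2 *)

Section SmoothStep.
Variable R : realType.
Implicit Types (r s x y : R) (p : {poly R}).

(** The polynomial factor in [x^-1] makes the family stable under differentiation, so all members
    are smooth at once. *)
Definition flat p x : R := if 0 < x then p.[x^-1] * expR (- x^-1) else 0.

Lemma expr_le_expR n : exists2 C : R, 0 <= C &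
  forall y, 0 <= y -> y ^+ n <= C * expR y.
Proof.
case: n => [|n].
  exists 1 => // y y0; rewrite expr0 mul1r.
  by apply: le_trans (expR_ge1Dx y); rewrite lerDl.
exists (n.+1)`!%:R => // y y0; have := expR_ge1Dxn n y0.
rewrite -ler_pdivrMl ?ltr0n ?fact_gt0 // mulrC; apply: le_trans.
by rewrite lerDr.
Qed.

Lemma horner_le_expR p n : exists2 C : R, 0 <= C &
  forall y, 0 <= y -> `|p.[y]| * y ^+ n <= C * expR y.
Proof.
elim/poly_ind: p n => [|p c IH] n.
  by exists 0 => // y y0; rewrite horner0 normr0 !mul0r.
have [C C0 CE] := IH n.+1; have [D D0 DE] := expr_le_expR n.
exists (C + `|c| * D); first by rewrite addr_ge0 // mulr_ge0.
move=> y y0; rewrite hornerMXaddC.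
apply: (@le_trans _ _ ((`|p.[y]| * y + `|c|) * y ^+ n)).
  rewrite ler_wpM2r ?exprn_ge0 //; apply: le_trans (ler_normD _ _) _.
  by rewrite normrM (ger0_norm y0).
rewrite !mulrDl lerD //; first by rewrite -mulrA -exprS CE.
by rewrite -mulrA ler_wpM2l // DE.
Qed.

Lemma is_derive_flat p x :
  is_derive x 1 (flat p) (flat ('X^2 * (p - p^`())) x).
Proof.
have [x0|x0|->] := ltgtP x 0.
- rewrite [flat _ x]/flat ltNge (ltW x0) /=.
  apply: near_eq_is_derive (is_derive_cst (0 : R) x 1).
  near=> y; rewrite /flat ltNge ltW //.
  by near: y; exact: lt_nbhsl.
- have dV : is_derive x 1 (fun y : R => y^-1) (- x ^- 2 *: 1).
    by apply: (@is_deriveV _ id) => //=; rewrite gt_eqF.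
  have dp := @is_derive1_comp _ (horner p) (fun y : R => y^-1) x _ _
    (is_derive_poly p x^-1) dV.
  have dN := is_deriveN dV.
  have de := @is_derive1_comp _ expR (- (fun y : R => y^-1)) x _ _
    (is_derive_expR (- x^-1)) dN.
  have dM := is_deriveM dp de.
  apply: near_eq_is_derive; last first.
    apply: is_derive_eq dM _.
    rewrite [RHS]/flat x0 /= /GRing.scale /= hornerM hornerXn hornerD hornerN.
    by rewrite -exprVn; ring.
  near=> y; rewrite /flat ifT //.
  by near: y; exact: lt_nbhsr.
- rewrite [flat _ 0]/flat ltxx; apply/is_derive1_caratheodory.
  (* Since [0^-1 = 0], this difference quotient takes at 0 the value 0, which is the derivative
     there. *)
  exists (fun z => flat p z / z); split; last by rewrite invr0 mulr0.
    move=> z; rewrite {2}/flat ltxx !subr0.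
    have [->|z0] := eqVneq z 0; last by rewrite divfK.
    by rewrite invr0 !mulr0 /flat ltxx.
  (* Exponent 2 pays for the division by [z] and leaves a further factor [z], which gives continuity
     at 0. *)
  have [C C0 CE] := horner_le_expR p 2.
  have bnd z : `|flat p z / z| <= C * `|z|.
    rewrite /flat; case: ifPn => z0; last by rewrite mul0r normr0 mulr_ge0.
    have y0 : 0 <= z^-1 by rewrite invr_ge0 ltW.
    have := CE _ y0; rewrite !normrM (gtr0_norm (expR_gt0 _)) (ger0_norm y0) expRN.
    rewrite (gtr0_norm z0) => h; rewrite mulrAC ler_pdivrMr ?expR_gt0 //.
    have -> : `|p.[z^-1]| * z^-1 = (`|p.[z^-1]| * z^-1 ^+ 2) * z.
      by rewrite expr2 -!mulrA mulVf ?mulr1 // gt_eqF.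
    by rewrite [leRHS]mulrAC ler_wpM2r // ltW.
  apply/cvgrPdist_le => e e0.
  have C1 : 0 < C + 1 by rewrite ltr_wpDl.
  near=> z; rewrite /= invr0 mulr0 sub0r normrN; apply: le_trans (bnd z) _.
  have : `|z| < e / (C + 1).
    near: z; apply/nbhs_ballP; exists (e / (C + 1)); first exact: divr_gt0.
    by move=> z; rewrite /ball /= sub0r normrN.
  rewrite ltr_pdivlMr // => /ltW; apply: le_trans.
  by rewrite mulrC ler_wpM2l // lerDl.
Unshelve. all: by end_near.
Qed.

Lemma smooth_flat p : smooth (flat p).
Proof.
move=> n; elim: n p => [//|n IH] p.
by exists (flat ('X^2 * (p - p^`()))) => //; exact: is_derive_flat.
Qed.

Lemma flat1_ge0 x : 0 <= flat 1 x.
Proof. by rewrite /flat; case: ifP => // _; rewrite hornerC mul1r expR_ge0. Qed.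

Lemma flat1_gt0 x : 0 < x -> 0 < flat 1 x.
Proof. by move=> x0; rewrite /flat x0 hornerC mul1r expR_gt0. Qed.

Lemma flat1_le0 x : x <= 0 -> flat 1 x = 0.
Proof. by move=> x0; rewrite /flat ltNge x0. Qed.

Lemma le_flat1 x y : x <= y -> flat 1 x <= flat 1 y.
Proof.
move=> xy; have [x0|x0] := leP x 0; first by rewrite flat1_le0 // flat1_ge0.
have y0 := lt_le_trans x0 xy.
by rewrite /flat x0 y0 !hornerC !mul1r ler_expR lerN2 lef_pV2.
Qed.

Definition smoothstep x : R := flat 1 x / (flat 1 x + flat 1 (1 - x)).

Let den_gt0 x : 0 < flat 1 x + flat 1 (1 - x).
Proof.
have [x0|x0] := leP x 0; last by rewrite ltr_wpDr ?flat1_ge0 ?flat1_gt0.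
by rewrite ltr_wpDl ?flat1_ge0 // flat1_gt0 //; lra.
Qed.

Lemma smooth_smoothstep : smooth smoothstep.
Proof.
move=> n; apply: (@CnM _ n (flat 1) (fun x => (flat 1 x + flat 1 (1 - x))^-1)).
  exact: smooth_flat.
apply: CnV => [x|]; first by rewrite gt_eqF.
apply: (@CnD _ n (flat 1) (fun x => flat 1 (1 - x))); first exact: smooth_flat.
rewrite (_ : (fun x => _) = flat 1 \o (cst 1 + cst (-1) * id)); last first.
  by apply/funext => x /=; rewrite [in RHS]/GRing.add /= mulN1r.
apply: Cn_comp; first exact: smooth_flat.
by apply: CnD; [exact: Cn_cst|apply: CnM; [exact: Cn_cst|exact: Cn_id]].
Qed.

Lemma smoothstep_le0 x : x <= 0 -> smoothstep x = 0.
Proof. by move=> x0; rewrite /smoothstep flat1_le0 ?mul0r. Qed.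

Lemma smoothstep_ge1 x : 1 <= x -> smoothstep x = 1.
Proof.
move=> x1; rewrite /smoothstep (@flat1_le0 (1 - x)) ?subr_le0 // addr0 divff //.
by rewrite gt_eqF // flat1_gt0 // (lt_le_trans ltr01).
Qed.

Lemma smoothstep_ge0 x : 0 <= smoothstep x.
Proof. by rewrite divr_ge0 ?flat1_ge0 // ltW. Qed.

Lemma le_smoothstep x y : x <= y -> smoothstep x <= smoothstep y.
Proof.
move=> xy; rewrite /smoothstep ler_pdivrMr // mulrAC ler_pdivlMr //.
have h1 := le_flat1 xy.
have h2 : flat 1 (1 - y) <= flat 1 (1 - x) by apply: le_flat1; lra.
rewrite !mulrDr [flat 1 y * flat 1 x]mulrC lerD2l.
by apply: ler_pM => //; exact: flat1_ge0.
Qed.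

Variable eta : R.
Hypothesis eta_gt0 : 0 < eta.

Definition smooth_h x : R := x + x * smoothstep (x / eta).

Lemma smooth_h_le0 x : x <= 0 -> smooth_h x = x.
Proof.
move=> x0; rewrite /smooth_h smoothstep_le0 ?mulr0 ?addr0 //.
by rewrite ler_pdivrMr // mul0r.
Qed.

Lemma smooth_h_ge x : eta <= x -> smooth_h x = 2 * x.
Proof.
move=> x0; rewrite /smooth_h smoothstep_ge1; first by rewrite mulr1; lra.
by rewrite ler_pdivlMr // mul1r.
Qed.

Lemma le_mul_smoothstep x y : x <= y ->
  x * smoothstep (x / eta) <= y * smoothstep (y / eta).
Proof.
move=> xy; have [x0|x0] := leP x 0.
  rewrite [X in X <= _](_ : _ = 0); last first.
    by rewrite smoothstep_le0 ?mulr0 // ler_pdivrMr // mul0r.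
  have [y0|y0] := leP y 0.
    by rewrite smoothstep_le0 ?mulr0 // ler_pdivrMr // mul0r.
  by rewrite mulr_ge0 ?smoothstep_ge0 // ltW.
apply: ler_pM => //; [exact: ltW|exact: smoothstep_ge0|].
by apply: le_smoothstep; rewrite ler_pM2r // invr_gt0.
Qed.

Lemma smooth_h_mono : {mono smooth_h : x y / x <= y}.
Proof.
apply: le_mono => x y xy; rewrite /smooth_h.
by rewrite ltr_leD // le_mul_smoothstep // ltW.
Qed.

Lemma smooth_smooth_h : smooth smooth_h.
Proof.
move=> n; apply: (@CnD _ n id (id * (smoothstep \o (id * cst eta^-1)))).
  exact: Cn_id.
apply: CnM; first exact: Cn_id.
apply: Cn_comp; first exact: smooth_smoothstep.
by apply: CnM; [exact: Cn_id|exact: Cn_cst].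
Qed.

(** Subtracting [x / 2] leaves a strictly increasing function, so the derivative is at least 1/2. *)
Lemma smooth_h_derive_neq0 F' : (forall x, is_derive x 1 smooth_h (F' x)) ->
  forall x, F' x != 0.
Proof.
move=> dF x; rewrite gt_eqF //; apply: (@lt_le_trans _ _ 2^-1) => //.
have dG y : is_derive y 1 (smooth_h - (cst 2^-1 * id)) (F' y - 2^-1).
  have d2 := is_deriveM (is_derive_cst (2^-1 : R) y 1) (is_derive_id y (1 : R)).
  apply: is_derive_eq (is_deriveB (dF y) d2) _.
  by rewrite /cst /GRing.scale /= mulr1 mulr0 addr0.
rewrite -subr_ge0 -(@derive_val _ _ _ _ _ _ _ (dG x)) -derive1E.
apply: (@incr_derive1_ge0 _ _ setT); last by rewrite interiorT.
  by move=> y _; exact: ex_derive.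
move=> y z _ _ yz.
have := le_mul_smoothstep (ltW yz); move=> ?.
change (y + y * smoothstep (y / eta) - 2^-1 * y < z + z * smoothstep (z / eta) - 2^-1 * z).
by lra.
Qed.

Lemma smooth_h_inverse : exists hi, [/\ cancel smooth_h hi, cancel hi smooth_h &
  smooth hi].
Proof.
have ch := smooth_continuous smooth_smooth_h.
have /choice[hi hiK] y : exists x, smooth_h x = y.
  have [y0|y0] := leP y 0; first by exists y; rewrite smooth_h_le0.
  have [||c _ cy] := @IVT R smooth_h 0 y y (ltW y0).
  - exact: continuous_subspaceT.
  - rewrite smooth_h_le0 // ge_min le_max (ltW y0) /= /smooth_h.
    by rewrite lerDl mulr_ge0 ?smoothstep_ge0 ?orbT // ltW.
  - by exists c.
have hK : cancel smooth_h hi by move=> x; apply: (inc_inj smooth_h_mono); rewrite hiK.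
exists hi; split=> //.
have [F' dF _] := smooth_derive smooth_smooth_h.
exact: smooth_inverse hK hiK smooth_smooth_h dF (smooth_h_derive_neq0 dF).
Qed.

End SmoothStep.

(** * Distortion of rotations *)

Section ClassDistorted.
Variable R : realType.

(** It is thus enough to work in the group of homeomorphisms with good lifts, contained in the group
    of interest. *)
Lemma distorted_in_sub (G : groupType) (H H' : set G) (f : G) : H `<=` H' ->
  distorted_in R H f -> distorted_in R H' f.
Proof.
by move=> HH' [Gamma [? GH ? ?]]; exists Gamma; split=> // x /GH; exact: HH'.
Qed.

Variable good : (R -> R) -> Prop.
Hypotheses (good_Tr : forall s, good (+%R^~ s))
  (good_comp : forall F G, good F -> good G -> good (F \o G))
  (good_continuous : forall F, good F -> continuous F)
  (good_local : forall F, (forall r, exists2 e, 0 < e & exists2 G, good G &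
     forall s, `|s - r| < e -> F s = G s) -> good F).

Variables (eta : R) (h hi : R -> R).
Hypotheses (eta_gt0 : 0 < eta) (eta_le : 40 * (50 * eta) <= 1).
Hypotheses (hK : cancel h hi) (hiK : cancel hi h).
Hypotheses (h_mono : {mono h : x y / x <= y})
  (h_le0 : forall r, r <= 0 -> h r = r)
  (h_ge : forall r, eta <= r -> h r = 2 * r).
Hypotheses (gh : good h) (ghi : good hi).

Lemma good_shift (F : R -> R) p : good F -> good (fun r => F (r - p) + p).
Proof.
by move=> gF; apply: (@good_comp (+%R^~ p) (F \o +%R^~ (- p))) => //; exact: good_comp.
Qed.

Lemma hpVE q K r : (hp hK hiK q)^-1%g K r = hi (r - q) + q.
Proof. by apply: sbijV_eq; rewrite hpE addrK hiK subrK. Qed.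

Lemma good_bump p c : good (bump hK hiK p c 0%N) /\ good ((bump hK hiK p c)^-1%g 0%N).
Proof.
have ghp q : good (hp hK hiK q 0%N).
  rewrite (_ : hp hK hiK q 0%N = fun r => h (r - q) + q); first exact: good_shift.
  by apply/funext => r; rewrite hpE.
have ghpV q : good ((hp hK hiK q)^-1%g 0%N).
  rewrite (_ : (hp hK hiK q)^-1%g 0%N = fun r => hi (r - q) + q); first exact: good_shift.
  by apply/funext => r; rewrite hpVE.
rewrite bump_def !invgM !invgK; split.
  by apply: (@good_comp (_ \o _)) => //; apply: (@good_comp (_ \o _)) => //; exact: good_comp.
by apply: good_comp => //; apply: good_comp => //; exact: good_comp.
Qed.

Lemma class_distorted alpha : irrational alpha ->
  distorted_in R (good_homeo good) (rotation R alpha).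
Proof.
move=> irr; apply: (@rotation_distorted _ _ _ _ _ _ alpha eta) => //.
- exact: good_homeo1.
- by move=> f g; exact: good_homeoM.
- exact: good_homeoV.
- exact: good_homeo_rot.
move=> beta d gam b_le bS dc.
exists ((turn beta)^-1 * (turn beta)^-1 * (turn beta)^-1)%g; last by [].
apply: (@short_turn3V _ eta eta_gt0 eta_le h hi hK hiK) bS dc => //.
- exact: good_homeo1.
- by move=> f g; exact: good_homeoM.
- exact: good_homeoV.
- exact: good_homeo_rot.
move=> p c p1 pc c99; have [gb gbV] := good_bump p c.
apply: (@periodize _ good good_Tr good_comp good_continuous good_local
  (1 / 100) (99 / 100) _ _ _ _ _ _ _ gb gbV); [lra|lra|lra| | |].
- by move=> K K' r; rewrite bump_def !sbijM !hpVE !hpE.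
- exact: mono_bump.
- exact: (supp_bump eta_gt0 eta_le).
Qed.

End ClassDistorted.

Theorem mainTheorem1 (R : realType) (alpha : R) (halpha : irrational alpha) :
  distorted_in R (PAff_plus R) (rotation R alpha) /\
  distorted_in R (Diff_infty R) (rotation R alpha).
Proof.
have [eta eta_gt0 eta_le] : exists2 eta : R, 0 < eta & 40 * (50 * eta) <= 1.
  by exists (1 / 40 / 50); lra.
split.
  (* For piecewise affine maps [h] is the hinge of slopes 1 and 2, with no transition zone at
     all. *)
  have hK : cancel (hinge (1 : R) 2) (hinge 1 2^-1).
    by apply: hingeK; rewrite ?mul1r ?mulVf.
  have hiK : cancel (hinge (1 : R) 2^-1) (hinge 1 2).
    by apply: hingeK; rewrite ?mul1r ?mulfV ?invr_gt0.
  apply: (@distorted_in_sub _ _ (good_homeo (@locally_affine R))).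
    by move=> f [F [G [_ _ mF [FA _] fF]]]; exact: PAff_lift fF mF FA.
  apply: (@class_distorted _ _ _ _ _ _ eta _ _ _ _ hK hiK) => //.
  - exact: locally_affine_Tr.
  - exact: locally_affine_comp.
  - exact: locally_affine_continuous.
  - exact: locally_affine_local.
  - exact: hinge_mono.
  - by move=> r r0; rewrite /hinge r0 mul1r.
  - by move=> r r0; rewrite /hinge ifN // -ltNge; exact: lt_le_trans r0.
  - exact: locally_affine_hinge.
  - exact: locally_affine_hinge.
have [hi [hK hiK shi]] := smooth_h_inverse eta_gt0.
apply: (@distorted_in_sub _ _ (good_homeo (@smooth R))).
  move=> f [F [G [FK GK mF [sF sG] fF]]]; split.
    by exists F; split=> //; exact: smooth_smooth_real.
  exists G; split; first exact: smooth_smooth_real.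
  by move=> r; rewrite -[in LHS](GK r) -fF /= homeo_funK.
apply: (@class_distorted _ _ _ _ _ _ eta _ _ _ _ hK hiK) => //.
- exact: smooth_Tr.
- by move=> F G sF sG n; exact: Cn_comp.
- exact: smooth_continuous.
- move=> F FG n; apply: Cn_local => r; have [e e0 [G sG GE]] := FG r.
  by exists e => //; exists G.
- exact: smooth_h_mono.
- exact: smooth_h_le0.
- exact: smooth_h_ge.
- exact: smooth_smooth_h.
Qed.
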